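(* Let $d\in\{2,3\}$ and $k>0$, let $D\subset\mathbb{R}^d$ be bounded and open, and let the nonlinear contrast $q$ (with linear part $q_0$ and exponent $\alpha>0$) satisfy the assumptions listed in the context. Then there exists $\delta>0$ such that for any $f\in U_\delta:=\{v\in L^\infty(D):\|v\|_{L^\infty(D)}\le\delta\}$ the nonlinear integral equation \[ v(x)=k^2\int_D\Phi_k(x-y)\,q\bigl(y,|v(y)+f(y)|\bigr)\,(v(y)+f(y))\,dy,\qquad x\in D, \] has a unique solution $v=V(f)\in L^\infty(D)$ satisfying $v-V_0f\in U_\delta$, and there exists a constant $C>0$ such that for all $f\in U_\delta$ \begin{align*} \|V(f)\|_{L^\infty(D)}&\le C\|f\|_{L^\infty(D)},\\ \|V(f)\|_{L^2(D)}&\le C\|f\|_{L^2(D)},\\ \|V(f)-V_0f\|_{L^\infty(D)}&\le C\|f\|_{L^\infty(D)}^{1+\alpha},\\ \|V(f)-V_0f\|_{L^2(D)}&\le C\|f\|_{L^\infty(D)}^{\alpha}\|f\|_{L^2(D)}. \end{align*}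
   Context: Assumptions on $q$. The contrast $q\in L^\infty(\mathbb{R}^d\times\mathbb{R})$ is real-valued and satisfies: (1) $\operatorname{supp}(q)\subseteq\overline D\times\mathbb{R}$; (2) $q(x,0)=0$ for a.e. $x\in\mathbb{R}^d$; (3) there are $q_0\in L^\infty(\mathbb{R}^d)$ with $\operatorname{ess\,inf}q_0>-1$ and $\operatorname{supp}(q_0)\subseteq\overline D$, a parameter $\alpha>0$ and a constant $C_q>0$ such that for any $z_1,z_2\in\mathbb{C}$ with $|z_1|,|z_2|\le1$, $\|q(\cdot,|z_1|)z_1-q(\cdot,|z_2|)z_2-q_0(z_1-z_2)\|_{L^\infty(\mathbb{R}^d)}\le C_q(|z_1|^\alpha+|z_2|^\alpha)|z_1-z_2|$. Notation. $\Phi_k$ is the outgoing fundamental solution of the Helmholtz equation: $\Phi_k(x)=\frac{\mathrm{i}}{4}H_0^{(1)}(k|x|)$ if $d=2$, $\Phi_k(x)=e^{\mathrm{i}k|x|}/(4\pi|x|)$ if $d=3$. For a function $h$ on $D$, $(\Phi_k\ast h)(x):=\int_D\Phi_k(x-y)h(y)\,dy$. $L^\infty(D)$, $L^2(D)$ consist of complex-valued functions. Linear solution operator. The operator $I-k^2\Phi_k\ast(q_0\,\cdot)$ is an isomorphism on $L^2(D)$ and on $L^\infty(D)$ (known), and $V_0$ is the bounded linear operator $V_0f:=(I-k^2\Phi_k\ast(q_0\,\cdot))^{-1}(k^2\Phi_k\ast(q_0f))$.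
   Formalization: Since q(y,|v(y)+f(y)|) is not determined by q as an element of L^∞(R^d×R), q is assumed to be a representative with t ↦ q(x,t) continuous on (0,1] for almost every x. *)

(* Defs.v *)
From HB Require Import structures.
From mathcomp Require Import all_boot all_order all_algebra.
From mathcomp Require Import complex.
From mathcomp Require Import all_classical all_reals all_analysis ess_sup_inf.

Set Implicit Arguments.
Unset Strict Implicit.
Unset Printing Implicit Defensive.
Import Order.TTheory GRing.Theory Num.Theory.
Import numFieldTopology.Exports numFieldNormedType.Exports.

Local Open Scope classical_set_scope.
Local Open Scope ring_scope.

(* The library topologizes ['rV[R]_n] but puts no sigma-algebra on it.  We take
   the one generated by the coordinates, that is, the Borel sets of R^n; the
   construction is the library's one for [n.-tuple T]. *)
Definition rV_display : measure_display -> measure_display.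
Proof. exact. Qed.

Section measurable_rV.
Context (R : realType) (n : nat).

Definition rV_coord (i : 'I_n) (x : 'rV[R]_n) : measurableTypeR R := x ord0 i.

Let rV_set0 : g_sigma_preimage rV_coord set0.
Proof. exact: sigma_algebra0. Qed.

Let rV_setC A : g_sigma_preimage rV_coord A -> g_sigma_preimage rV_coord (~` A).
Proof. exact: sigma_algebraC. Qed.

Let rV_bigcup (F : (set 'rV[R]_n)^nat) :
  (forall i, g_sigma_preimage rV_coord (F i)) ->
  g_sigma_preimage rV_coord (\bigcup_i (F i)).
Proof. exact: sigma_algebra_bigcup. Qed.

HB.instance Definition _ := @isMeasurable.Build (rV_display default_measure_display)
  'rV[R]_n (g_sigma_preimage rV_coord) rV_set0 rV_setC rV_bigcup.

End measurable_rV.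

Lemma measurable_fun_rVP (R : realType) d (T : measurableType d) n
    (f : T -> 'rV[R]_n) :
  measurable_fun [set: T] f <->
  forall i, measurable_fun [set: T] (@rV_coord R n i \o f).
Proof.
apply: (@iff_trans _
  (g_sigma_preimage (fun i => @rV_coord R n i \o f) `<=` measurable)).
  rewrite (@g_sigma_preimage_comp _ (measurableTypeR R) n 'rV[R]_n).
  split=> [mf A [/= C preC <-]|prefS].
    exact: mf.
  by move=> _ A mA; apply: prefS; exists A.
split=> [tnthfS i|mf].
- move=> _ A mA.
  apply: tnthfS; apply: sub_sigma_algebra.
  case: n i => [[] []//|n i] in f *.
  rewrite -bigcup_mkord_ord.
  exists i; first exact: ltn_ord.
  by exists A => //; rewrite inord_val.
- apply: smallest_sub; first exact: sigma_algebra_measurable.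
  case: n => [|n] in f mf *; first by rewrite big_ord0.
  rewrite -bigcup_mkord_ord; apply: bigcup_sub => i Ii.
  by move=> A [B mB <-]; exact: mf.
Qed.

Lemma measurable_rV_coord (R : realType) n (i : 'I_n) :
  measurable_fun [set: 'rV[R]_n] (@rV_coord R n i).
Proof.
exact: (proj1 (measurable_fun_rVP (@idfun 'rV[R]_n)) (@measurable_id _ _ _) i).
Qed.

Definition rV_rcons (R : realType) n
    (p : 'rV[R]_n * measurableTypeR R) : 'rV[R]_n.+1 :=
  \row_(i < n.+1) if unlift ord_max i is Some j then p.1 ord0 j else p.2.

Lemma measurable_rV_rcons (R : realType) n :
  measurable_fun [set: 'rV[R]_n * measurableTypeR R] (@rV_rcons R n).
Proof.
apply/measurable_fun_rVP => i.
case ui : (unlift ord_max i) => [j|].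
- rewrite (_ : _ \o _ = @rV_coord R n j \o fst); last first.
    by apply/funext => p /=; rewrite /rV_coord mxE ui.
  apply: measurableT_comp => //.
  exact: measurable_rV_coord.
- rewrite (_ : _ \o _ = snd) //.
  by apply/funext => p /=; rewrite /rV_coord mxE ui.
Qed.

Section lebesgue_rV.
Context (R : realType).

(* Lebesgue measure on R^n, by induction on n: the image of
   [leb n \x lebesgue_measure] under [rV_rcons]. *)
Fixpoint leb n : {measure set 'rV[R]_n -> \bar R} :=
  if n is m.+1 then
    measure_function_pushforward__canonical__measure_function_Measure
      (leb m \x @lebesgue_measure R)%E (@measurable_rV_rcons R m)
  else @dirac _ 'rV[R]_0 0 R.

Lemma measurable_box n (A : 'I_n -> set (measurableTypeR R)) :
  (forall i, measurable (A i)) ->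
  measurable [set x : 'rV[R]_n | forall i, A i (x ord0 i)].
Proof.
move=> mA; rewrite [X in measurable X](_ : _ =
  \big[setI/setT]_(i < n) (@rV_coord R n i @^-1` A i)).
  apply: bigsetI_measurable => i _; rewrite -[X in measurable X]setTI.
  exact: measurable_rV_coord.
rewrite -bigcap_seq; apply/seteqP; split => x /= h i; first by move=> _; exact: h.
by apply: (h i); rewrite /= mem_index_enum.
Qed.

Lemma leb_box n (A : 'I_n -> set (measurableTypeR R)) :
  (forall i, measurable (A i)) ->
  (leb n [set x : 'rV[R]_n | forall i, A i (x ord0 i)] =
   \prod_(i < n) lebesgue_measure (A i))%E.
Proof.
elim: n => [|n IH] in A *; move=> mA.
  rewrite big_ord0 /= diracE (_ : _ \in _ = true) //.
  by apply/mem_set => -[].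
have mA' i : measurable (A (widen_ord (leqnSn n) i)) by exact: mA.
rewrite big_ord_recr /= -(IH _ mA').
rewrite -(product_measure1E _ _ (measurable_box mA') (mA ord_max)).
rewrite /pushforward; congr (product_measure1 _ _ _).
apply/seteqP; split => -[x t] /=.
- move=> h; split => [i|].
    have := h (widen_ord (leqnSn n) i); rewrite mxE.
    rewrite (_ : widen_ord _ i = lift ord_max i) ?liftK//.
    by apply/val_inj; rewrite /= /bump leqNgt ltn_ord.
  by have := h ord_max; rewrite mxE unlift_none.
- move=> [hx ht] i; rewrite mxE; case: unliftP => [j ->|->] //=.
  rewrite (_ : lift ord_max j = widen_ord (leqnSn n) j) //.
  by apply/val_inj; rewrite /= /bump leqNgt ltn_ord.
Qed.
End lebesgue_rV.

Local Open Scope complex_scope.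

Section complex_lebesgue_spaces.
Context (R : realType) (d : nat).
Implicit Types (D : set 'rV[R]_d) (p : \bar R) (f g h : 'rV[R]_d -> R[i]).

(* [`|z|] on [R[i]] is complex-valued; [normc z] is the modulus as a real. *)
Definition cnorm (z : R[i]) : R := Normc.normc z.

Definition cintegral D h : R[i] :=
  (\int[leb R d]_(x in D) complex.Re (h x)) +i*
  (\int[leb R d]_(x in D) complex.Im (h x)).

(* Functions on [D] are represented by functions on R^d whose values off [D]
   are ignored; elements of L^p(D) are compared with [_ = _ %[ae leb R d in D]]. *)
Definition Lpnorm p D f : \bar R :=
  'N[leb R d]_p[(fun x => (cnorm (f x))%:E) \_ D]%E.

Definition Lp p D : set ('rV[R]_d -> R[i]) :=
  [set f | [/\ measurable_fun D (fun x => complex.Re (f x)),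
               measurable_fun D (fun x => complex.Im (f x)) &
               (Lpnorm p D f < +oo)%E]].

Definition Linfty_ball D (delta : R) : set ('rV[R]_d -> R[i]) :=
  [set v | Lp +oo D v /\ (Lpnorm +oo D v <= delta%:E)%E].

Definition bounded_linear_on p D
    (T : ('rV[R]_d -> R[i]) -> 'rV[R]_d -> R[i]) : Prop :=
  [/\ forall h, Lp p D h -> Lp p D (T h),
      forall (a : R[i]) g h, Lp p D g -> Lp p D h ->
        T (fun x => a * g x + h x) = (fun x => a * T g x + T h x)
          %[ae leb R d in D] &
      exists C : R, forall h, Lp p D h ->
        (Lpnorm p D (T h) <= C%:E * Lpnorm p D h)%E].

Definition isomorphism_on p D
    (T : ('rV[R]_d -> R[i]) -> 'rV[R]_d -> R[i]) : Prop :=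
  bounded_linear_on p D T /\
  exists S, [/\ bounded_linear_on p D S,
    forall h, Lp p D h -> S (T h) = h %[ae leb R d in D] &
    forall h, Lp p D h -> T (S h) = h %[ae leb R d in D]].

End complex_lebesgue_spaces.

(* The complement of the largest open set on which [f] vanishes [mu]-a.e. *)
Definition ess_supp (R : realType) (T : topologicalType) (mu : set T -> \bar R)
    (f : T -> R) : set T :=
  ~` \bigcup_(U in [set U | open U /\ mu (U `&` [set x | f x != 0]) = 0%E]) U.

Section fundamental_solution.
Context (R : realType).
Implicit Types (t k : R).

Definition besselJ0 t : R :=
  limn (series (fun m => (-1) ^+ m * (t / 2) ^+ (2 * m) / m`!%:R ^+ 2)).

Definition euler_gamma : R :=
  limn (fun n => series harmonic n - ln n%:R).

(* Y_0(t) = (2/pi) ((ln (t/2) + gamma) J_0(t)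
      + sum_(m >= 1) (-1)^(m+1) H_m (t/2)^(2m) / (m!)^2),
   where H_m = 1 + 1/2 + ... + 1/m = [series harmonic m]. *)
Definition besselY0 t : R :=
  2 / pi * ((ln (t / 2) + euler_gamma) * besselJ0 t +
    limn (series (fun m => (-1) ^+ m.+1 * series harmonic m *
                           (t / 2) ^+ (2 * m) / m`!%:R ^+ 2))).

Definition hankel0 t : R[i] := besselJ0 t +i* besselY0 t.

(* The library norm on ['rV[R]_d] is the sup norm. *)
Definition enorm d (x : 'rV[R]_d) : R :=
  Num.sqrt (\sum_(i < d) x ord0 i ^+ 2).

(* Only meaningful for d = 2 and d = 3. *)
Definition Phi d k (x : 'rV[R]_d) : R[i] :=
  if d == 2%N then 'i / 4 * hankel0 (k * enorm x)
  else (cos (k * enorm x) +i* sin (k * enorm x)) / (4 * pi * enorm x)%:C.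

End fundamental_solution.

Section scattering.
Context (R : realType) (d : nat).
Implicit Types (D : set 'rV[R]_d) (k delta : R) (f h v : 'rV[R]_d -> R[i]).

Definition potential k D h : 'rV[R]_d -> R[i] :=
  fun x => cintegral D (fun y => Phi k (x - y) * h y).

Definition linear_part k D (q0 : 'rV[R]_d -> R) h : 'rV[R]_d -> R[i] :=
  fun x => (k ^+ 2)%:C * potential k D (fun y => (q0 y)%:C * h y) x.

Definition linear_op k D (q0 : 'rV[R]_d -> R) h : 'rV[R]_d -> R[i] :=
  fun x => h x - linear_part k D q0 h x.

(* [(linear_op k D q0)^-1 (linear_part k D q0 f)], the inverse being taken on
   L^2(D), which contains L^oo(D) as [D] is bounded.  When [linear_op k D q0] is
   an isomorphism of both spaces, the two inverses agree on L^oo(D). *)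
Definition V0 k D (q0 : 'rV[R]_d -> R) f : 'rV[R]_d -> R[i] :=
  xget (cst 0) [set w | Lp 2%:E D w /\
    linear_op k D q0 w = linear_part k D q0 f %[ae leb R d in D]].

Record contrast D (q : 'rV[R]_d -> R -> R) (q0 : 'rV[R]_d -> R)
    (alpha : R) : Prop := Contrast {
  contrast_Linfty :
    (fun p : 'rV[R]_d * measurableTypeR R => q p.1 p.2) \in
      Lfun (leb R d \x @lebesgue_measure R)%E +oo%E;
  contrast_supp :
    ess_supp (leb R d \x @lebesgue_measure R)%E
      (fun p : 'rV[R]_d * R => q p.1 p.2) `<=` closure D `*` setT;
  contrast0 : {ae leb R d, forall x, q x 0 = 0};
  linear_contrast_Linfty : q0 \in Lfun (leb R d) +oo%E;
  linear_contrast_gtN1 : (-1%:E < ess_inf (leb R d) (EFin \o q0))%E;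
  linear_contrast_supp : ess_supp (leb R d) q0 `<=` closure D;
  contrast_alpha : 0 < alpha;
  contrast_lipschitz : exists2 Cq : R, 0 < Cq &
    forall z1 z2 : R[i], cnorm z1 <= 1 -> cnorm z2 <= 1 ->
      (Lpnorm +oo setT (fun x => (q x (cnorm z1))%:C * z1
          - (q x (cnorm z2))%:C * z2 - (q0 x)%:C * (z1 - z2))%R
       <= (Cq * (cnorm z1 `^ alpha + cnorm z2 `^ alpha)
              * cnorm (z1 - z2))%:E)%E
}.

(* [q] is given up to null sets of R^d x R, whereas [y |-> q y (cnorm (w y))]
   depends on the representative.  The Lipschitz condition of [contrast] implies
   that there is one which is continuous in t on ]0, 1] for almost every x; the
   superposition is understood with such a representative. *)
Definition continuous_representative (q : 'rV[R]_d -> R -> R) : Prop :=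
  {ae leb R d, forall x, {within `]0, 1], continuous (q x)}}.

Definition integral_equation k D (q : 'rV[R]_d -> R -> R) f v : Prop :=
  v = (fun x => (k ^+ 2)%:C *
        potential k D (fun y => (q y (cnorm (v y + f y)))%:C * (v y + f y)) x)
    %[ae leb R d in D].

End scattering.

(* Main.v *)
(* Write T = I - k^2 Phi * (q0 .) and G(w) = q(., |w|) w - q0 w.  With
v = V0 f + u the integral equation becomes the fixed-point equation
u = F(u) := T^-1 (k^2 Phi * G(V0 f + f + u)).  The Lipschitz condition on the contrast
gives |G(w1) - G(w2)| <= C (|w1|^alpha + |w2|^alpha) |w1 - w2| almost
everywhere, so on a small ball of L^oo the map F is a contraction for the sup norm
and, with the same small constant, Lipschitz for the L^2 norm.  Picard iteration
gives existence and uniqueness, and all four estimates follow from u = F(u) and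
the superlinear bound on G.

Convolution with Phi is bounded on L^oo(D) and on L^2(D) by Schur's test, once
|Phi(x)| <= C/|x| near the origin, for d = 3 by the formula and for d = 2 from
the logarithmic singularity of Y_0; the function 1/|x| is integrated over D by
comparing it with a geometric sum of indicators of dyadic cubes.
*)

From HB Require Import structures.
Require Import Defs.
From mathcomp Require Import all_boot all_order all_algebra.
From mathcomp Require Import complex.
From mathcomp Require Import all_classical all_reals all_analysis ess_sup_inf.
From mathcomp Require Import measurable_realfun ring lra.
Import Order.TTheory GRing.Theory Num.Theory.
Import numFieldTopology.Exports numFieldNormedType.Exports.
Local Open Scope classical_set_scope.
Local Open Scope ring_scope.

Set Implicit Arguments.
Unset Strict Implicit.
Unset Printing Implicit Defensive.

(** * Fixed points of small perturbations *)

(** Three obstacles shape the argument. The Lipschitz condition on [q] holds off a null set that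
    depends on the pair of complex numbers, whereas [G] evaluates it at [w1 x] and [w2 x], which
    vary with [x]. It is therefore collected over the countably many pairs of rational points and
    then extended to all pairs by continuity of the representative. Next, functions equal almost
    everywhere are not identified, so the fixed-point argument runs on plain functions with
    seminorms, and equality almost everywhere is recorded as a vanishing seminorm. Finally,
    smallness and completeness are demanded of the sup norm only; the L^2 norm is merely transported
    along the fixed point. Every operator is thus estimated in both norms, but on bounded functions,
    and the inverse on L^2 through which [V0] is defined has to be matched with the inverse on L^oo
    through which [F] is defined. *)

Section seminorm_on.
Context {R : realType} {X : zmodType} (E : set X).

(** The model is [fine] of an L^p norm, for which the triangle inequality is meaningful only where
    the norms are finite, hence the restriction to [E]. Stating it for differences yields symmetry
    under negation as well, by subtracting from 0. *)
Record seminorm_on (n : X -> R) : Prop := SeminormOn {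
  seminorm_on_ge0 : forall x, 0 <= n x;
  seminorm_on0 : n 0 = 0;
  seminorm_onB : forall x y, E x -> E y -> n (x - y) <= n x + n y }.

Hypotheses (E0 : E 0) (EB : forall x y, E x -> E y -> E (x - y)).

Lemma seminorm_on_stableD x y : E x -> E y -> E (x + y).
Proof. by move=> Ex Ey; rewrite -(opprK y) -(sub0r y); apply: EB => //; exact: EB. Qed.

Context (n : X -> R) (hn : seminorm_on n).

Lemma seminorm_onN x : E x -> n (- x) = n x.
Proof.
have le y : E y -> n (- y) <= n y.
  by move=> Ey; have := seminorm_onB hn E0 Ey; rewrite sub0r (seminorm_on0 hn) add0r.
move=> Ex; apply/eqP; rewrite eq_le le//= -{1}(opprK x) le//.
by rewrite -sub0r; exact: EB.
Qed.

Lemma seminorm_onD x y : E x -> E y -> n (x + y) <= n x + n y.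
Proof.
move=> Ex Ey; rewrite -(seminorm_onN Ey) -{1}(opprK y); apply: seminorm_onB => //.
by rewrite -sub0r; exact: EB.
Qed.

Lemma seminorm_on_distC x y : E x -> E y -> n (x - y) = n (y - x).
Proof. by move=> Ex Ey; rewrite -(seminorm_onN (EB Ey Ex)) opprB. Qed.

Lemma seminorm_on_trans z x y : E x -> E y -> E z ->
  n (x - y) <= n (x - z) + n (z - y).
Proof.
move=> Ex Ey Ez; rewrite -(subrKA z); apply: seminorm_onD; exact: EB.
Qed.

End seminorm_on.

(** The radius serves two purposes: [M * (M + 2) * r ^ alpha <= 1] makes the map preserve the ball
    of radius [r / (M + 2)], and the factor 4 bounds its Lipschitz constant [2 * M * r ^ alpha] by
    1/2. *)
Lemma exists_contraction_radius (R : realType) (M alpha : R) :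
  1 <= M -> 0 < alpha -> exists r : R, [/\ 0 < r, r <= 1 &
  4 * M * (M + 2) * r `^ alpha <= 1].
Proof.
move=> M1 alpha0; set s := (4 * M * (M + 2))^-1.
have M0 : 0 < 4 * M * (M + 2) by apply: mulr_gt0; lra.
have s0 : 0 < s by rewrite invr_gt0.
exists (Num.min 1 (s `^ alpha^-1)); split.
- by rewrite lt_min ltr01 powR_gt0.
- by rewrite ge_min lexx.
- rewrite mulrC -ler_pdivlMr// div1r -/s.
  have {2}-> : s = (s `^ alpha^-1) `^ alpha.
    by rewrite -powRrM mulVf ?gt_eqF// powRr1// ltW.
  apply: ge0_ler_powR; rewrite ?nnegrE ?powR_ge0 ?(ltW alpha0)//.
  + by rewrite le_min ler01 powR_ge0.
  + by rewrite ge_min lexx orbT.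
Qed.

(** To be read with [n1] the sup norm, [n2] the L^2 norm, [L] the operator [V0] and [F] the map
    applied to [v + f]. Completeness is stated with an explicit geometric rate, so that [X] needs no
    topology. The bound on [(M + 2) * delta] is exported because it keeps [v + f] in the unit ball,
    where [q] is controlled. *)
Lemma small_perturbation_fixed_point (R : realType) (X : zmodType) (E : set X)
    (n1 n2 : X -> R) (F L : X -> X) (M alpha : R)
    (E0 : E 0) (EB : forall x y, E x -> E y -> E (x - y))
    (h1 : seminorm_on E n1) (h2 : seminorm_on E n2)
    (n12 : forall x, E x -> n1 x = 0 -> n2 x = 0)
    (n1_complete : forall (u : nat -> X) (c : R), (forall i, E (u i)) ->
       (forall i, n1 (u i.+1 - u i) <= c / 2 ^+ i) ->
       exists2 l, E l & forall i, n1 (u i - l) <= 2 * c / 2 ^+ i)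
    (M1 : 1 <= M) (alpha0 : 0 < alpha)
    (EF : forall w, E w -> n1 w <= 1 -> E (F w))
    (F_lip : forall n w1 w2, n = n1 \/ n = n2 -> E w1 -> E w2 ->
       n1 w1 <= 1 -> n1 w2 <= 1 ->
       n (F w1 - F w2) <= M * (n1 w1 `^ alpha + n1 w2 `^ alpha) * n (w1 - w2))
    (F0 : n1 (F 0) = 0)
    (EL : forall f, E f -> E (L f))
    (L_bnd : forall n f, n = n1 \/ n = n2 -> E f -> n (L f) <= M * n f) :
  exists2 delta : R, 0 < delta /\ (M + 2) * delta <= 1 &
  exists2 C : R, 0 < C & forall f, E f -> n1 f <= delta ->
  exists v, [/\ E v, n1 (v - L f - F (v + f)) = 0, n1 (v - L f) <= delta,
    (forall v', E v' -> n1 (v' - L f - F (v' + f)) = 0 ->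
       n1 (v' - L f) <= delta -> n1 (v' - v) = 0) &
    [/\ n1 v <= C * n1 f, n2 v <= C * n2 f,
     n1 (v - L f) <= C * n1 f `^ (1 + alpha) &
     n2 (v - L f) <= C * (n1 f `^ alpha * n2 f)]].
Proof.
have hn n : n = n1 \/ n = n2 -> seminorm_on E n by case=> ->.
have ED x y : E x -> E y -> E (x + y) by exact: seminorm_on_stableD.
have FB n w : n = n1 \/ n = n2 -> E w -> n1 w <= 1 ->
    n (F w) <= M * n1 w `^ alpha * n w.
    move=> hnn Ew w1; have n0 : n (F 0) = 0.
    case: hnn => -> //; apply: n12 => //; apply: EF => //.
    by rewrite (seminorm_on0 h1).
  have := F_lip _ _ _ hnn Ew E0 w1; rewrite (seminorm_on0 h1) => /(_ ler01).
  rewrite powR0 ?gt_eqF// addr0 subr0 => H.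
  have EF0 : E (F 0) by apply: EF => //; rewrite (seminorm_on0 h1).
  rewrite -[F w](subrK (F 0)); apply: (le_trans (seminorm_onD E0 EB (hn _ hnn) _ _)) => //.
    by apply: EB => //; exact: EF.
  by rewrite n0 addr0.
have [r [r0 r1 rM]] := exists_contraction_radius M1 alpha0.
have M2 : 0 < M + 2 by lra.
(* The argument of [F] is [u + L f + f], of size at most [delta + M * delta + delta], which is
   [r]. *)
pose delta := r / (M + 2).
have rE : (M + 2) * delta = r by rewrite /delta mulrC divfK// gt_eqF.
have d0 : 0 < delta by rewrite divr_gt0.
(* This is what the superlinear bound [M * n1 w ^ alpha * n w] gives once [w = l + g] is known to be
   at most [2 * (M + 1)] times [f] in both seminorms. *)
set B := M * (2 * (M + 1)) `^ alpha * (2 * (M + 1)).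
have B0 : 0 <= B by rewrite /B !mulr_ge0 ?powR_ge0//; lra.
exists delta; first by rewrite rE.
exists (B + 2 * M + 1); first lra.
move=> f Ef fd.
have n_ge0 n x : n = n1 \/ n = n2 -> 0 <= n x.
  by case=> ->; [exact: seminorm_on_ge0 h1 _|exact: seminorm_on_ge0 h2 _].
have [nn1 nn2] : (n1 = n1 \/ n1 = n2) /\ (n2 = n1 \/ n2 = n2) by split; [left|right].
set g := L f + f.
have Eg : E g by apply: ED => //; exact: EL.
have gle n : n = n1 \/ n = n2 -> n g <= (M + 1) * n f.
  move=> nn; apply: (le_trans (seminorm_onD E0 EB (hn _ nn) (EL _ Ef) Ef)).
  by rewrite mulrDl mul1r lerD2r L_bnd.
pose Phi u := F (u + g).
have wle u : E u -> n1 u <= delta -> n1 (u + g) <= r.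
  move=> Eu ud; apply: (le_trans (seminorm_onD E0 EB h1 Eu Eg)).
  rewrite -rE (_ : (M + 2) * delta = delta + (M + 1) * delta); last by ring.
  apply: lerD => //; apply: (le_trans (gle _ nn1)).
  by rewrite ler_pM2l//; lra.
have powle w : E w -> n1 w <= r -> n1 w `^ alpha <= r `^ alpha.
  move=> Ew wr; apply: ge0_ler_powR; rewrite ?nnegrE ?(ltW alpha0) ?(ltW r0)//.
  exact: n_ge0.
have ra0 : 0 <= r `^ alpha by exact: powR_ge0.
have Mra : M * r `^ alpha <= 4^-1 by nra.
have EPhi u : E u -> n1 u <= delta -> E (Phi u).
  move=> Eu ud; apply: EF; first exact: ED.
  exact: le_trans (wle _ Eu ud) r1.
have Phi_d u : E u -> n1 u <= delta -> n1 (Phi u) <= delta.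
  move=> Eu ud; have w := wle _ Eu ud.
  have Ew : E (u + g) by exact: ED.
  apply: (le_trans (FB _ _ nn1 Ew (le_trans w r1))).
  apply: (@le_trans _ _ (M * r `^ alpha * r)).
    apply: ler_pM => //; rewrite ?n_ge0//.
      by rewrite mulr_ge0 ?powR_ge0//; lra.
    by apply: ler_pM; rewrite ?powR_ge0 ?powle//; lra.
  by rewrite -{2}rE mulrA ler_piMl ?ltW//; lra.
have Phi_lip u v : E u -> n1 u <= delta -> E v -> n1 v <= delta ->
    n1 (Phi u - Phi v) <= 2^-1 * n1 (u - v).
  move=> Eu ud Ev vd.
  have Ewu : E (u + g) by exact: ED.
  have Ewv : E (v + g) by exact: ED.
  have wu := wle _ Eu ud; have wv := wle _ Ev vd.
  have := F_lip _ _ _ nn1 Ewu Ewv (le_trans wu r1) (le_trans wv r1).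
  rewrite [X in n1 X <= _ -> _](_ : _ = Phi u - Phi v)//.
  rewrite opprD addrACA subrr addr0 => H.
  apply: (le_trans H); apply: ler_wpM2r; first exact: n_ge0.
  have := powle _ Ewu wu; have := powle _ Ewv wv.
  move: (n1 (u + g) `^ alpha) (n1 (v + g) `^ alpha) => a b; nra.
pose u := fun i : nat => iter i Phi 0.
have u_d i : E (u i) /\ n1 (u i) <= delta.
  elim: i => [|i [Ei di]] /=; last by split; [exact: EPhi|exact: Phi_d].
  by split => //; rewrite (seminorm_on0 h1) ltW.
have u_step i : n1 (u i.+1 - u i) <= delta / 2 ^+ i.
  elim: i => [|i ih].
    by rewrite expr0 divr1 subr0; exact: (u_d 1).2.
  apply: (le_trans (Phi_lip (u i.+1) (u i) (u_d _).1 (u_d _).2 (u_d _).1 (u_d _).2)).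
  by rewrite exprS invfM mulrCA ler_pM2l// invr_gt0.
have [l El lim_l] := n1_complete _ _ (fun i => (u_d i).1) u_step.
have geo0 (a b c : R) : (forall i, a <= b + c / 2 ^+ i) -> a <= b.
  move=> H; apply/ler_addgt0Pr => e e0.
  have : (fun i : nat => c / 2 ^+ i) @ \oo --> (0 : R).
    rewrite -(mulr0 c); under eq_fun do rewrite -exprVn.
    by apply: cvgMr; apply: cvg_expr; rewrite ger0_norm ?invr_ge0// invf_lt1//; lra.
  move=> /cvgrPdist_lt /(_ _ e0)[N _ /(_ N (leqnn N))] /=.
  rewrite sub0r normrN => /ltW; rewrite ler_norml => /andP[_ ?].
  by apply: (le_trans (H N)); rewrite lerD2l.
have ld : n1 l <= delta.
  apply: (geo0 _ _ (2 * delta)) => i.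
  rewrite -[l](subrK (u i)); apply: (le_trans (seminorm_onD E0 EB h1 (EB _ _ El (u_d i).1) (u_d i).1)).
  rewrite addrC; apply: lerD; first exact: (u_d i).2.
  by rewrite (seminorm_on_distC E0 EB h1)//; exact: (u_d i).1.
have lfix : n1 (l - Phi l) = 0.
  apply/eqP; rewrite eq_le n_ge0// andbT.
  apply: (geo0 _ _ (2 * delta)) => i; rewrite add0r.
  apply: (le_trans (seminorm_on_trans E0 EB h1 (z := u i.+1) El (EPhi _ El ld) (u_d _).1)).
  rewrite [leRHS](_ : _ = 2 * delta / 2 ^+ i.+1 + 2^-1 * (2 * delta / 2 ^+ i)); last first.
    by rewrite exprS; field; rewrite expf_neq0.
  apply: lerD; first by rewrite (seminorm_on_distC E0 EB h1)//; exact: (u_d _).1.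
  apply: (le_trans (Phi_lip _ _ (u_d _).1 (u_d _).2 El ld)).
  by rewrite ler_pM2l.
have Ew : E (l + g) by exact: ED.
have wr := wle _ El ld.
(* The limit is a fixed point only up to [n1]-null elements; [n12] makes the discrepancy invisible
   to [n2] too. *)
have Fle n : n = n1 \/ n = n2 -> n l <= M * n1 (l + g) `^ alpha * n (l + g).
  move=> nn; rewrite -[l in n l](subrK (Phi l)).
  apply: (le_trans (seminorm_onD E0 EB (hn _ nn) (EB _ _ El (EPhi _ El ld)) (EPhi _ El ld))).
  have -> : n (l - Phi l) = 0.
    by case: nn => ->//; apply: n12 => //; apply: EB => //; exact: EPhi.
  by rewrite add0r; apply: FB => //; exact: le_trans wr r1.
have wle2 n : n = n1 \/ n = n2 -> n (l + g) <= n l + (M + 1) * n f.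
  move=> nn; apply: (le_trans (seminorm_onD E0 EB (hn _ nn) El Eg)).
  by rewrite lerD2l gle.
(* The unknown [n l] also occurs on the right of [Fle], through [n (l + g)], but with a factor at
   most 1/4, so it can be absorbed. *)
have lle n : n = n1 \/ n = n2 -> n l <= (M + 1) * n f.
  move=> nn; have := Fle _ nn; have := wle2 _ nn; have := powle _ Ew wr.
  have := n_ge0 _ l nn; have := n_ge0 _ (l + g) nn; have := n_ge0 _ f nn.
  have := powR_ge0 (n1 (l + g)) alpha.
  move: (n1 (l + g) `^ alpha) (n (l + g)) (n l) (n f) => a b c e a0 e0 b0 c0 H1 H2 H3.
  have : M * a * b <= 4^-1 * b by apply: ler_wpM2r => //; nra.
  nra.
have wle3 n : n = n1 \/ n = n2 -> n (l + g) <= 2 * (M + 1) * n f.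
  by move=> nn; apply: (le_trans (wle2 _ nn)); have := lle _ nn; lra.
have final n : n = n1 \/ n = n2 -> n l <= B * (n1 f `^ alpha * n f).
  move=> nn; apply: (le_trans (Fle _ nn)).
  rewrite /B (_ : _ * _ * _ * (_ * _) =
    M * ((2 * (M + 1)) `^ alpha * n1 f `^ alpha) * (2 * (M + 1) * n f)); last by ring.
  apply: ler_pM; rewrite ?n_ge0 ?wle3//.
    by rewrite mulr_ge0 ?powR_ge0//; lra.
  rewrite ler_pM2l; last lra.
  rewrite -powRM ?n_ge0//; last lra.
  apply: ge0_ler_powR; rewrite ?nnegrE ?(ltW alpha0) ?wle3 ?(n_ge0 n1)//.
  by rewrite mulr_ge0 ?(n_ge0 n1)//; lra.
have vLf : l + L f - L f = l by rewrite addrK.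
exists (l + L f); split.
- by apply: ED => //; exact: EL.
- by rewrite vLf -addrA.
- by rewrite vLf.
(* Both [v' - L f] and [l] are fixed points in the ball, so their distance is at most half of
   itself. *)
- move=> v' Ev' v'fix v'd.
  have Eu' : E (v' - L f) by apply: EB => //; exact: EL.
  have v'E : v' + f = (v' - L f) + g by rewrite addrA subrK.
  move: v'fix; rewrite v'E -/(Phi _) => u'fix.
  rewrite opprD addrA addrAC.
  move: (v' - L f) Eu' v'd u'fix => u' Eu' u'd u'fix.
  have := seminorm_on_trans E0 EB h1 (z := Phi u') Eu' El (EPhi _ Eu' u'd).
  have := seminorm_on_trans E0 EB h1 (z := Phi l) (EPhi _ Eu' u'd) El (EPhi _ El ld).
  rewrite u'fix (seminorm_on_distC E0 EB h1 (EPhi _ El ld) El) ?lfix.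
  have := Phi_lip _ _ Eu' u'd El ld; have := n_ge0 _ (u' - l) nn1.
  move: (n1 (u' - l)) (n1 (Phi u' - l)) (n1 (Phi u' - Phi l)) => a b c *; lra.
- have vle n : n = n1 \/ n = n2 -> n (l + L f) <= (B + 2 * M + 1) * n f.
    move=> nn; apply: (le_trans (seminorm_onD E0 EB (hn _ nn) El (EL _ Ef))).
    have := lle _ nn; have := L_bnd _ _ nn Ef.
    have : 0 <= B * n f by rewrite mulr_ge0 ?n_ge0.
    have := n_ge0 _ f nn; lra.
  have C0 : B <= B + 2 * M + 1 by lra.
  rewrite vLf; split; [exact: vle|exact: vle| |].
  + apply: (le_trans (final _ nn1)).
    rewrite powRD; last by rewrite (_ : 1 + alpha == 0 = false)//; apply/eqP; lra.
    rewrite powRr1 ?n_ge0// (mulrC (n1 f)); apply: ler_wpM2r => //.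
    by rewrite mulr_ge0 ?powR_ge0 ?n_ge0.
  + apply: (le_trans (final _ nn2)); apply: ler_wpM2r => //.
    by rewrite mulr_ge0 ?powR_ge0 ?n_ge0.
Qed.

(** * Lebesgue measure on R^n *)

(** The sigma-algebra is generated by coordinates and the topology by the sup norm. They meet
    because an open set is the union of the boxes with rational endpoints that it contains, and
    there are countably many of these. *)
Lemma open_rV_measurable (R : realType) n (D : set 'rV[R]_n) :
  open D -> measurable D.
Proof.
move=> oD.
pose box (b : {ffun 'I_n -> rat * rat}) : set 'rV[R]_n :=
  [set x | forall i, x ord0 i \in `](ratr (b i).1), (ratr (b i).2)[].
have mbox b : measurable (box b).
  exact: (@measurable_box R n (fun i => [set` `](ratr (b i).1), (ratr (b i).2)[])).
pose F b := if `[< box b `<=` D >] then box b else set0.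
have -> : D = \bigcup_b F b.
  apply/seteqP; split => [x Dx|x [b _]]; last first.
    by rewrite /F; case: ifPn => // /asboolP; exact.
  move: oD; rewrite openE => /(_ _ Dx); rewrite /interior => /nbhs_ballP[e /= e0 eD].
  have loq i : exists q : rat, ratr q \in `](x ord0 i - e), (x ord0 i)[.
    by apply: rat_in_itvoo; rewrite ltrBlDr ltrDl.
  have hiq i : exists q : rat, ratr q \in `](x ord0 i), (x ord0 i + e)[.
    by apply: rat_in_itvoo; rewrite ltrDl.
  have /choice[lo lo_itv] := loq; have /choice[hi hi_itv] := hiq.
  exists [ffun i => (lo i, hi i)] => //; rewrite /F asboolT => [i|y /= yb].
    rewrite ffunE/= in_itv/=.
    by move: (lo_itv i) (hi_itv i); rewrite !in_itv/= => /andP[_ ->] /andP[->].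
  apply: eD; split => // i j; rewrite !ord1; have := yb j; rewrite ffunE/= in_itv/=.
  move: (lo_itv j) (hi_itv j); rewrite !in_itv/= => /andP[a1 a2] /andP[b1 b2] /andP[c1 c2].
  by rewrite /ball/= /ball/= ltr_norml; lra.
apply: countable_bigcupT_measurable => // b.
by rewrite /F; case: ifP.
Qed.

Definition cube (R : realType) n (x : 'rV[R]_n) (r : R) : set 'rV[R]_n :=
  [set y | forall i, `|x ord0 i - y ord0 i| < r].

Lemma cubeE (R : realType) n (x : 'rV[R]_n) (r : R) :
  cube x r = [set y | forall i,
    [set` `](x ord0 i - r), (x ord0 i + r)[] (y ord0 i)].
Proof.
apply/seteqP; split => y /= h i; have := h i; rewrite in_itv/= ltr_norml.
  by move=> /andP[? ?]; apply/andP; lra.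
by move=> /andP[? ?]; apply/andP; lra.
Qed.

Lemma leb_cube (R : realType) n (x : 'rV[R]_n) (r : R) : 0 <= r ->
  leb R n (cube x r) = ((2 * r) ^+ n)%:E.
Proof.
move=> r0.
rewrite cubeE.
rewrite (@leb_box R n (fun i => [set` `](x ord0 i - r), (x ord0 i + r)[]))//.
rewrite (eq_bigr (fun=> (2 * r)%:E)); last first.
  move=> i _; rewrite lebesgue_measure_itv/= lte_fin.
  case: ifPn => [_|]; first by rewrite -EFinD; congr EFin; ring.
  by rewrite -leNgt => ?; congr EFin; lra.
by rewrite prodEFin prodr_const card_ord.
Qed.

Lemma measurable_cube (R : realType) n (x : 'rV[R]_n) (r : R) :
  measurable (cube x r).
Proof.
rewrite cubeE.
exact: (@measurable_box R n (fun i => [set` `](x ord0 i - r), (x ord0 i + r)[])).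
Qed.

Lemma ler_coord_norm (R : realType) n (x : 'rV[R]_n) i : `|x ord0 i| <= `|x|.
Proof. by rewrite {2}/Num.norm/= mx_normrE; apply/bigmax_geP; right; exists (ord0, i). Qed.

Lemma bounded_setP_lt (R : realType) n (D : set 'rV[R]_n) : bounded_set D ->
  exists2 r : R, 0 < r & forall x, D x -> `|x| < r.
Proof.
move=> [M [_ MD]]; exists (`|M| + 2) => [|x Dx]; first by rewrite ltr_wpDl.
apply: (@le_lt_trans _ _ (`|M| + 1)); last by rewrite ltrD2l ltrDl.
by apply: MD => //; rewrite (le_lt_trans (ler_norm _))// ltrDl.
Qed.

Lemma leb_bounded_lty (R : realType) n (D : set 'rV[R]_n) : measurable D ->
  bounded_set D -> (leb R n D < +oo)%E.
Proof.
move=> mD /bounded_setP_lt[r r0 Dr].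
apply: (@le_lt_trans _ _ (leb R n (cube 0 r))).
  apply: le_measure; rewrite ?inE//; first exact: measurable_cube.
  by move=> x Dx i /=; rewrite mxE sub0r normrN (le_lt_trans (ler_coord_norm _ _))// Dr.
by rewrite leb_cube ?ltW// ltey.
Qed.

Lemma sigma_finite_leb (R : realType) n : sigma_finite [set: 'rV[R]_n] (leb R n).
Proof.
exists (fun k => cube 0 k%:R).
  apply/seteqP; split => // x _; exists (Num.truncn `|x|).+1 => // i /=.
  rewrite mxE sub0r normrN (le_lt_trans (ler_coord_norm _ _))//.
  exact: truncnS_gt.
move=> k; split; first exact: measurable_cube.
by rewrite leb_cube// ltey.
Qed.

(* [leb R n] carries no sigma-finite structure, which Tonelli's theorem needs;
   this copy does. *)
Definition sfleb (R : realType) n : set 'rV[R]_n -> \bar R := leb R n.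

HB.instance Definition _ (R : realType) n := Measure.on (@sfleb R n).
HB.instance Definition _ (R : realType) n :=
  Measure_isSigmaFinite.Build _ _ _ (@sfleb R n) (sigma_finite_leb R n).

(** * The fundamental solution *)

Section exp_dominated_series.
Context {R : realType} (c : R^nat).
Hypothesis cle : forall m, `|c m| <= m`!%:R^-1.

(** Both Bessel series are power series in [(t / 2) ^+ 2] whose coefficients are at most [1 / m!],
    so the exponential series is a common majorant for convergence and size. *)
Lemma normed_exp_dominated_series (s : R) :
  cvgn [normed series (fun m => c m * s ^+ m)].
Proof.
apply: (series_le_cvg (v_ := exp_coeff `|s|)) => [n|n|n|].
- exact: normr_ge0.
- by rewrite exp_coeff_ge0.
- by rewrite /= normrM normrX mulrC ler_wpM2l// exprn_ge0.
- exact: is_cvg_series_exp_coeff.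
Qed.

Lemma is_cvg_exp_dominated_series (s : R) :
  cvgn (series (fun m => c m * s ^+ m)).
Proof. exact/normed_cvg/normed_exp_dominated_series. Qed.

Lemma ler_norm_exp_dominated_series (s : R) :
  `|limn (series (fun m => c m * s ^+ m))| <= expR `|s|.
Proof.
apply: (le_trans (lim_series_norm (@normed_exp_dominated_series s))).
apply: lim_series_le => [||n].
- exact: normed_exp_dominated_series.
- exact: is_cvg_series_exp_coeff.
- by rewrite /= normrM normrX mulrC ler_wpM2l// exprn_ge0.
Qed.

Lemma measurable_exp_dominated_series :
  measurable_fun [set: R] (fun s : R => limn (series (fun m => c m * s ^+ m))).
Proof.
apply: (measurable_fun_cvg (h := fun n (s : R) => series (fun m => c m * s ^+ m) n)).
  move=> n; apply: measurable_sum => m.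
  by apply: measurable_funM => //; exact: measurable_funX.
by move=> s _; exact: is_cvg_exp_dominated_series.
Qed.

End exp_dominated_series.

Section bessel.
Context {R : realType}.
Implicit Types t k : R.

Let cJ m : R := (-1) ^+ m / m`!%:R ^+ 2.
Let cY m : R := (-1) ^+ m.+1 * series harmonic m / m`!%:R ^+ 2.

Let cJ_le m : `|cJ m| <= m`!%:R^-1.
Proof.
rewrite /cJ normrM normrX normrN1 expr1n mul1r normfV normrX normr_nat.
rewrite lef_pV2 ?posrE ?exprn_gt0 ?ltr0n ?fact_gt0//.
by rewrite expr2 ler_peMr ?ler1n ?fact_gt0.
Qed.

(** The harmonic sum is at most [m], hence at most [m!], which uses up one of the two factorials in
    the denominator. *)
Let cY_le m : `|cY m| <= m`!%:R^-1.
Proof.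
have h0 : 0 <= series harmonic m :> R by apply: sumr_ge0 => i _; exact: harmonic_ge0.
have hle : series harmonic m <= m`!%:R :> R.
  apply: (@le_trans _ _ m%:R); last by rewrite ler_nat fact_geq.
  rewrite -[leRHS](_ : \sum_(0 <= i < m) 1 = _); last by rewrite sumr_const_nat subn0.
  by apply: ler_sum => i _; rewrite /= invf_le1 ?ltr0n// ler1n.
have m0 : 0 < m`!%:R :> R by rewrite ltr0n fact_gt0.
rewrite /cY !normrM normrX normrN1 expr1n mul1r normfV normrX normr_nat (ger0_norm h0).
by rewrite ler_pdivrMr ?exprn_gt0// expr2 mulKf// gt_eqF.
Qed.

Let besselJ0E t : besselJ0 t = limn (series (fun m => cJ m * ((t / 2) ^+ 2) ^+ m)).
Proof.
by rewrite /besselJ0; congr (limn (series _)); apply/funext => m; rewrite /cJ -exprM mulrAC.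
Qed.

Let besselY0E t : besselY0 t = 2 / pi * ((ln (t / 2) + euler_gamma R) * besselJ0 t +
  limn (series (fun m => cY m * ((t / 2) ^+ 2) ^+ m))).
Proof.
rewrite /besselY0; congr (_ * _); congr (_ + _);
  congr (limn (series _)); apply/funext => m.
by rewrite /cY -exprM mulrAC.
Qed.

Lemma measurable_besselJ0 : measurable_fun setT (@besselJ0 R).
Proof.
rewrite (funext besselJ0E).
apply: (measurableT_comp (measurable_exp_dominated_series cJ_le)).
by apply: measurable_funX; exact: measurable_funM.
Qed.

Lemma measurable_besselY0 : measurable_fun setT (@besselY0 R).
Proof.
rewrite (funext besselY0E).
apply: measurable_funM => //; apply: measurable_funD.
  apply: measurable_funM; last exact: measurable_besselJ0.
  apply: measurable_funD => //.
  by apply: measurableT_comp; [exact: measurable_ln|exact: measurable_funM].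
apply: (measurableT_comp (measurable_exp_dominated_series cY_le)).
by apply: measurable_funX; exact: measurable_funM.
Qed.

Lemma besselJ0_le t L : 0 < t <= L -> `|besselJ0 t| <= expR (L ^+ 2).
Proof.
move=> /andP[t0 tL]; rewrite besselJ0E.
apply: (le_trans (ler_norm_exp_dominated_series cJ_le _)).
rewrite ler_expR ger0_norm ?exprn_ge0 ?divr_ge0 ?(ltW t0)//.
by rewrite ler_pXn2r ?nnegrE//; lra.
Qed.

(** Replacing the logarithmic singularity by the cruder [1 / t] costs nothing, since [1 / |x|] is
    integrable near 0 in the plane, and it lets both dimensions share one kernel estimate. *)
Lemma besselY0_le L : exists C : R, forall t, 0 < t <= L -> `|besselY0 t| <= C / t.
Proof.
pose g := `|euler_gamma R|; pose e := expR (L ^+ 2).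
(* After multiplication by [t <= L], the logarithm contributes [L ^+ 2 + 2] and Euler's constant
   [L * g], both times [J_0]; the other series contributes [L * e]. The exponential [e] bounds both
   series. *)
exists (`|2 / pi| * ((L ^+ 2 + 2 + L * g) * e + L * e)) => t /andP[t0 tL].
have J := @besselJ0_le t L; rewrite t0 tL in J; have {}J := J isT.
rewrite besselY0E normrM -mulrA ler_wpM2l//.
rewrite ler_pdivlMr// (le_trans (ler_wpM2r (ltW t0) (ler_normD _ _)))//.
set S := limn _; have Se : `|S| <= e.
  apply: (le_trans (ler_norm_exp_dominated_series cY_le _)).
  rewrite ler_expR ger0_norm ?exprn_ge0 ?divr_ge0 ?(ltW t0)//.
  by rewrite ler_pXn2r ?nnegrE//; lra.
rewrite mulrDl; apply: lerD; last first.
  by rewrite mulrC; apply: ler_pM => //; exact: ltW.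
rewrite normrM mulrAC; apply: ler_pM => //.
  by rewrite mulr_ge0// ltW.
apply: (le_trans (ler_wpM2r (ltW t0) (ler_normD _ _))).
rewrite mulrDl; apply: lerD; last by rewrite mulrC; apply: ler_pM => //; exact: ltW.
have t20 : 0 < t / 2 by lra.
have l1 := ln_sublinear t20.
have l2 : - ln (t / 2) < 2 / t.
  rewrite -lnV ?posrE// invf_div; apply: ln_sublinear; exact: divr_gt0.
(* This is [ln s < s] applied to [t / 2] and to its inverse. *)
have : `|ln (t / 2)| <= t / 2 + 2 / t.
  have : 0 <= 2 / t by rewrite divr_ge0// ltW.
  by rewrite ler_norml; lra.
move=> /(ler_wpM2r (ltW t0)) /le_trans; apply.
rewrite mulrDl divfK ?gt_eqF// lerD2r.
by nra.
Qed.

End bessel.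

Local Open Scope complex_scope.

(** * The modulus of a complex number *)

Section cnorm.
Context {R : realType}.
Implicit Types (x y z : R[i]) (a b : R).

Lemma cnormE z : cnorm z = Num.sqrt (complex.Re z ^+ 2 + complex.Im z ^+ 2).
Proof. by case: z. Qed.

Lemma cnorm_ge0 z : 0 <= cnorm z.
Proof. by rewrite cnormE sqrtr_ge0. Qed.

Lemma cnorm0 : cnorm (0 : R[i]) = 0.
Proof. exact: Normc.normc0. Qed.

Lemma cnorm_eq0 z : cnorm z = 0 -> z = 0.
Proof. exact: Normc.eq0_normc. Qed.

Lemma cnormM x y : cnorm (x * y) = cnorm x * cnorm y.
Proof. exact: Normc.normcM. Qed.

Lemma cnormN x : cnorm (- x) = cnorm x.
Proof. exact: normcN. Qed.

Lemma cnormB x y : cnorm (x - y) = cnorm (y - x).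
Proof. by rewrite -cnormN opprB. Qed.

Lemma ler_cnormD x y : cnorm (x + y) <= cnorm x + cnorm y.
Proof. exact: le_normcD. Qed.

Lemma ler_cnormB x y : cnorm (x - y) <= cnorm x + cnorm y.
Proof. by rewrite -(cnormN y) ler_cnormD. Qed.

Lemma cnorm_real a : cnorm a%:C = `|a|.
Proof. by rewrite cnormE/= expr0n addr0 sqrtr_sqr. Qed.

Lemma normr_Re_le z : `|complex.Re z| <= cnorm z.
Proof. by rewrite cnormE -sqrtr_sqr ler_sqrt ?lerDl ?addr_ge0 ?sqr_ge0. Qed.

Lemma normr_Im_le z : `|complex.Im z| <= cnorm z.
Proof. by rewrite cnormE -sqrtr_sqr ler_sqrt ?lerDr ?addr_ge0 ?sqr_ge0. Qed.

Lemma cnorm_le_ReIm z : cnorm z <= `|complex.Re z| + `|complex.Im z|.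
Proof.
rewrite cnormE -[leRHS]ger0_norm ?addr_ge0// -sqrtr_sqr ler_sqrt ?sqr_ge0//.
rewrite sqrrD !real_normK ?num_real// lerD2r lerDl.
by rewrite mulrn_wge0// mulr_ge0.
Qed.

Lemma ReM x y : complex.Re (x * y) =
  complex.Re x * complex.Re y - complex.Im x * complex.Im y.
Proof. by case: x y => [a b] [c d]. Qed.

Lemma ImM x y : complex.Im (x * y) =
  complex.Re x * complex.Im y + complex.Im x * complex.Re y.
Proof. by case: x y => [a b] [c d]. Qed.

Lemma ReD x y : complex.Re (x + y) = complex.Re x + complex.Re y.
Proof. by case: x y => [a b] [c d]. Qed.

Lemma ImD x y : complex.Im (x + y) = complex.Im x + complex.Im y.
Proof. by case: x y => [a b] [c d]. Qed.

Lemma ReN x : complex.Re (- x) = - complex.Re x.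
Proof. by case: x. Qed.

Lemma ImN x : complex.Im (- x) = - complex.Im x.
Proof. by case: x. Qed.

Lemma complex_eqP x y :
  complex.Re x = complex.Re y -> complex.Im x = complex.Im y -> x = y.
Proof. by case: x y => [a b] [c d] /= -> ->. Qed.

End cnorm.

Lemma measurable_cnorm d (T : measurableType d) (R : realType) (A : set T)
    (f : T -> R[i]) :
  measurable_fun A (fun x => complex.Re (f x)) ->
  measurable_fun A (fun x => complex.Im (f x)) ->
  measurable_fun A (fun x => cnorm (f x)).
Proof.
move=> mr mi; under eq_fun do rewrite cnormE.
apply: (measurableT_comp (continuous_measurable_fun (@sqrt_continuous R))).
by apply: measurable_funD; exact: measurable_funX.
Qed.

Section Phi.
Context {R : realType}.
Implicit Types k : R.

Lemma Phi2E k (x : 'rV[R]_2) :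
  Phi k x = (- besselY0 (k * enorm x) / 4) +i* (besselJ0 (k * enorm x) / 4).
Proof.
rewrite /Phi eqxx.
have -> : 'i / 4 = 0 +i* 4^-1 :> R[i].
  rewrite -[4]/(4%:R) -(rmorph_nat (real_complex R)) -fmorphV -complexiE.
  by apply: complex_eqP; rewrite ?ReM ?ImM/= ?mul0r ?mul1r ?mulr0 ?subr0 ?addr0 ?add0r.
by apply: complex_eqP; rewrite ?ReM ?ImM/= ?mul0r ?mulr0 ?add0r ?sub0r ?mulNr mulrC// .
Qed.

Lemma Phi3E k (x : 'rV[R]_3) :
  Phi k x = (cos (k * enorm x) / (4 * pi * enorm x)) +i*
            (sin (k * enorm x) / (4 * pi * enorm x)).
Proof.
rewrite /Phi/= -fmorphV.
by apply: complex_eqP; rewrite ?ReM ?ImM/= ?mulr0 ?subr0 ?addr0 ?add0r.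
Qed.

Lemma enormN n (x : 'rV[R]_n) : enorm (- x) = enorm x.
Proof. by rewrite /enorm; under eq_bigr do rewrite mxE sqrrN. Qed.

Lemma PhiN n k (x : 'rV[R]_n) : Phi k (- x) = Phi k x.
Proof. by rewrite /Phi enormN. Qed.

Lemma ler_norm_enorm n (x : 'rV[R]_n) : `|x| <= enorm x.
Proof.
rewrite {1}/Num.norm/= mx_normrE; apply/bigmax_leP; split; first exact: sqrtr_ge0.
move=> [i j] _ /=; rewrite ord1 -sqrtr_sqr ler_sqrt ?sumr_ge0// => [|l _]; last exact: sqr_ge0.
by rewrite (bigD1 j)//= lerDl sumr_ge0// => l _; exact: sqr_ge0.
Qed.

Lemma ler_enorm_norm n (x : 'rV[R]_n) : enorm x <= n.+1%:R * `|x|.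
Proof.
have n0 : 0 <= n.+1%:R * `|x| by rewrite mulr_ge0.
rewrite -[leRHS]ger0_norm// -sqrtr_sqr ler_sqrt ?sqr_ge0//.
apply: (@le_trans _ _ (\sum_(i < n) `|x| ^+ 2)).
  apply: ler_sum => i _; rewrite -real_normK ?num_real//.
  by rewrite ler_pXn2r ?nnegrE// ler_coord_norm.
rewrite sumr_const card_ord exprMn -[_ *+ n]mulr_natl ler_wpM2r ?sqr_ge0// -natrX ler_nat.
by rewrite -mulnn (leq_trans (leqnSn n))// leq_pmulr.
Qed.

Lemma measurable_enorm n : measurable_fun [set: 'rV[R]_n] (@enorm R n).
Proof.
apply: (measurableT_comp (continuous_measurable_fun (@sqrt_continuous R))).
apply: measurable_sum => i; apply: measurable_funX; exact: measurable_rV_coord.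
Qed.

(** On nonnegative numbers inversion is the power with exponent -1, at 0 as well, where both take
    the value 0. *)
Lemma measurable_fun_inv_ge0 d (T : measurableType d) (f : T -> R) :
  (forall x, 0 <= f x) -> measurable_fun setT f -> measurable_fun setT (fun x => (f x)^-1).
Proof.
move=> f0 mf; under eq_fun do rewrite -powR_inv1//.
exact: (measurableT_comp (measurable_powR (-1)) mf).
Qed.

Lemma measurable_Phi d k : d = 2%N \/ d = 3%N ->
  measurable_fun [set: 'rV[R]_d] (fun x => complex.Re (Phi k x)) /\
  measurable_fun [set: 'rV[R]_d] (fun x => complex.Im (Phi k x)).
Proof.
have mk n : measurable_fun [set: 'rV[R]_n] (fun x => k * enorm x).
  by apply: measurable_funM => //; exact: measurable_enorm.
case=> -> {d}.
  split; under eq_fun do rewrite Phi2E/=; apply: measurable_funM => //.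
    exact: measurable_funN (measurableT_comp measurable_besselY0 (mk _)).
  exact: (measurableT_comp measurable_besselJ0 (mk _)).
have mi : measurable_fun [set: 'rV[R]_3] (fun x => (4 * pi * enorm x)^-1 : R).
  apply: measurable_fun_inv_ge0 => [x|].
    by rewrite !mulr_ge0 ?pi_ge0// sqrtr_ge0.
  by apply: measurable_funM => //; exact: measurable_enorm.
split; under eq_fun do rewrite Phi3E/=; apply: measurable_funM => //.
  exact: (measurableT_comp (continuous_measurable_fun (@continuous_cos R)) (mk _)).
exact: (measurableT_comp (continuous_measurable_fun (@continuous_sin R)) (mk _)).
Qed.

(** The origin is excluded because [C / 0] is 0 there, while the value of [Phi] is an artefact of
    the formula. The bound is first found in terms of the Euclidean norm and then passed to the
    smaller sup norm. *)
Lemma Phi_le d k (L : R) : d = 2%N \/ d = 3%N -> 0 < k ->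
  exists2 C : R, 0 < C & forall x : 'rV[R]_d, x != 0 -> `|x| <= L -> cnorm (Phi k x) <= C / `|x|.
Proof.
move=> hd k0.
suff [C HC] : exists C : R, forall x : 'rV[R]_d, 0 < enorm x <= d.+1%:R * L ->
    cnorm (Phi k x) <= C / enorm x.
  exists (`|C| + 1) => [|x x0 xL]; first by rewrite ltr_wpDl.
  have nx : 0 < `|x| by rewrite normr_gt0.
  have ex : 0 < enorm x by rewrite (lt_le_trans nx)// ler_norm_enorm.
  apply: (le_trans (HC x _)).
    by rewrite ex (le_trans (ler_enorm_norm x))// ler_wpM2l.
  apply: (@le_trans _ _ ((`|C| + 1) / enorm x)).
    by rewrite ler_pM2r ?invr_gt0// ler_wpDr// ler_norm.
  by rewrite ler_pM2l ?ltr_wpDl// lef_pV2 ?posrE// ler_norm_enorm.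
case: hd => ->.
  have [CY hY] := besselY0_le (k * (3%:R * L)).
  pose T := k * (3%:R * L); pose e := expR (T ^+ 2).
  (* The bounded term [J_0] is also put in the form of a multiple of [1 / t], by [e <= e * T / t]
     for [t <= T]. *)
  exists ((CY + e * T) / (4 * k)) => x /andP[x0 xL].
  have t0 : 0 < k * enorm x by rewrite mulr_gt0.
  have tT : 0 < k * enorm x <= T by rewrite t0/= ler_pM2l.
  rewrite Phi2E (le_trans (cnorm_le_ReIm _))//= mulNr normrN !(normrM _ 4^-1).
  rewrite (ger0_norm (_ : 0 <= 4^-1)) ?invr_ge0// -mulrDl.
  rewrite (_ : _ / _ / _ = (CY / (k * enorm x) + e * T / (k * enorm x)) / 4); last first.
    by field; rewrite !gt_eqF.
  rewrite ler_pM2r ?invr_gt0//; apply: lerD; first exact: (hY _ tT).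
  apply: (le_trans (besselJ0_le tT)).
  by rewrite -/e -mulrA ler_peMr ?expR_ge0// ler_pdivlMr// mul1r; case/andP: tT.
exists (2 / (4 * pi)) => x /andP[x0 xL].
rewrite Phi3E (le_trans (cnorm_le_ReIm _))//= !normrM -mulrDl.
have p0 : 0 < 4 * pi * enorm x :> R by rewrite !mulr_gt0// pi_gt0.
rewrite (ger0_norm (_ : 0 <= _^-1)) ?invr_ge0 ?(ltW p0)//.
rewrite [leRHS](_ : _ = 2 * (4 * pi * enorm x)^-1); last by rewrite (invfM _ (enorm x)) mulrA.
rewrite ler_pM2r ?invr_gt0// (_ : 2 = 1 + 1)//; apply: lerD.
  by rewrite ler_norml cos_geN1 cos_le1.
by rewrite ler_norml sin_geN1 sin_le1.
Qed.

End Phi.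

(** * Integrals of kernels with a [1 / |x|] singularity *)

Lemma measurable_rV_subl (R : realType) d (x : 'rV[R]_d) :
  measurable_fun [set: 'rV[R]_d] (fun y => x - y).
Proof.
apply/measurable_fun_rVP => i; rewrite (_ : _ \o _ = (fun y => x ord0 i - rV_coord i y)).
  by apply: measurable_funB => //; exact: measurable_rV_coord.
by apply/funext => y; rewrite /= /rV_coord !mxE.
Qed.

Lemma dyadic_shell (R : realType) (L t : R) : 0 < t < L ->
  exists n : nat, L / 2 ^+ n.+1 <= t < L / 2 ^+ n.
Proof.
move=> /andP[t0 tL].
have : exists n, L / 2 ^+ n <= t.
  have [n Hn] : exists n, L / t <= 2 ^+ n.
    exists (Num.truncn (L / t)).+1; apply: ltW; apply: (lt_le_trans (truncnS_gt _)).
    by rewrite -natrX ler_nat ltnW// ltn_expl.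
  by exists n; rewrite ler_pdivrMr ?exprn_gt0// mulrC -ler_pdivrMr.
move=> /ex_minnP[[|n] Hn Hmin]; first by move: Hn; rewrite expr0 divr1 leNgt tL.
exists n; rewrite Hn/= ltNge; apply/negP => /Hmin; by rewrite ltnn.
Qed.

(* [V] takes care of [y = x], where [C / `|x - y|] is the junk value 0. *)
Lemma integral_inv_norm_le (R : realType) d (D : set 'rV[R]_d) (L C V : R) :
  (2 <= d)%N -> measurable D -> (leb R d D < +oo)%E -> 0 < L -> 0 <= C -> 0 <= V ->
  exists2 M : R, 0 < M & forall (x : 'rV[R]_d) (K : 'rV[R]_d -> R),
    measurable_fun D K ->
    (forall y, D y -> `|x - y| < L) -> (forall y, D y -> 0 <= K y) ->
    (D x -> K x <= V) ->
    (forall y, D y -> y != x -> K y <= C / `|x - y|) ->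
    (\int[leb R d]_(y in D) (K y)%:E <= M%:E)%E.
Proof.
move=> d2 mD Doo L0 C0 V0.
(* On the shell where [|x - y|] lies between [L / 2 ^ (n + 1)] and [L / 2 ^ n], this is an upper
   bound for [C / |x - y|]. *)
pose a n : R := C * 2 ^+ n.+1 / L.
have a0 n : 0 <= a n by rewrite /a mulr_ge0 ?invr_ge0 ?(ltW L0)// mulr_ge0 ?exprn_ge0.
(* The cube of radius [L / 2 ^ n] has measure [(2 * L) ^ d / 2 ^ (n * d)]. Since [d >= 2], its
   product with [a n] is at most [r / 2 ^ (n + 1)], and these numbers sum to [r]. *)
pose r := 4 * C * (2 * L) ^+ d / L.
have r0 : 0 <= r by rewrite /r mulr_ge0 ?invr_ge0 ?(ltW L0)// !mulr_ge0 ?exprn_ge0 ?mulr_ge0 ?(ltW L0).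
have fD : leb R d D \is a fin_num by rewrite ge0_fin_numE.
exists (V * fine (leb R d D) + r + 1).
  by rewrite ltr_wpDl// addr_ge0// mulr_ge0// fine_ge0.
move=> x K mK xL K0 KV KC.
pose S n (y : 'rV[R]_d) : \bar R := (a n * \1_(cube x (L / 2 ^+ n)) y)%:E.
have S0 n y : (0 <= S n y)%E by rewrite lee_fin mulr_ge0.
have mS n : measurable_fun D (S n).
  apply/measurable_EFinP; apply: measurable_funM => //.
  by apply: measurable_indic; exact: measurable_cube.
have KS y : D y -> ((K y)%:E <= V%:E + \sum_(n <oo) S n y)%E.
  move=> Dy; have [yx|yx] := eqVneq y x.
    rewrite -[leLHS]adde0; apply: leeD; last exact: nneseries_ge0.
    by rewrite lee_fin yx KV// -yx.
  rewrite -[leLHS]add0e; apply: leeD; first by rewrite lee_fin.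
  have xy0 : 0 < `|x - y| < L by rewrite normr_gt0 subr_eq0 eq_sym yx xL.
  have [n /andP[n1 n2]] := dyadic_shell xy0.
  have n0 : 0 < L / 2 ^+ n.+1 by rewrite divr_gt0 ?exprn_gt0.
  apply: (@le_trans _ _ (S n y)).
    rewrite lee_fin indicE mem_set; last first.
      move=> i /=; rewrite (le_lt_trans _ n2)//.
      by have := ler_coord_norm (x - y) i; rewrite !mxE.
    rewrite mulr1; apply: (le_trans (KC _ Dy yx)).
    by rewrite /a -mulrA ler_wpM2l// -[leRHS]invrK lef_pV2 ?posrE ?invr_gt0
      ?divr_gt0 ?exprn_gt0 ?invf_div//; case/andP: xy0.
  apply: le_trans; last exact: (nneseries_lim_ge n.+1).
  by rewrite big_nat_recr//= leeDr// sume_ge0.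
apply: (@le_trans _ _ (\int[leb R d]_(y in D) (V%:E + \sum_(n <oo) S n y))%E).
  apply: ge0_le_integral => //.
  - exact/measurable_EFinP.
  - apply: emeasurable_funD => //; exact: ge0_emeasurable_sum.
rewrite ge0_integralD//; last 2 first.
- by move=> y _; exact: nneseries_ge0.
- exact: ge0_emeasurable_sum.
rewrite integral_cst// integral_nneseries//.
rewrite -addrA EFinD; apply: leeD; first by rewrite EFinM fineK.
apply: (@le_trans _ _ (\sum_(n <oo) (r / (2 ^ (n + 1))%:R)%:E)%E); last first.
  have /(cvg_lim (@ereal_hausdorff R)) := @cvg_geometric_eseries_half R r 0.
  by rewrite expr0 divr1 => H; apply: (@le_trans _ _ r%:E); rewrite ?lee_fin ?lerDl// -[leRHS]H.
apply: lee_nneseries => [n *|n *]; first by apply: integral_ge0 => y _; exact: S0.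
under eq_integral do rewrite /S EFinM.
rewrite ge0_integralZl_EFin//; last first.
  by apply/measurable_EFinP; apply: measurable_indic; exact: measurable_cube.
rewrite integral_indic//; last exact: measurable_cube.
apply: (@le_trans _ _ ((a n)%:E * leb R d (cube x (L / 2 ^+ n)))%E).
  apply: lee_wpmul2l; rewrite ?lee_fin//.
  by apply: le_measure; rewrite ?inE//; [apply: measurableI => //|]; exact: measurable_cube.
rewrite leb_cube ?divr_ge0 ?(ltW L0)// -EFinM lee_fin.
rewrite /a /r mulrA exprMn exprVn -exprM natrX addn1.
rewrite [leLHS](_ : _ = (4 * C * (2 * L) ^+ d / L) * (2 ^+ n / 2 / 2 ^+ (n * d))); last first.
  by rewrite exprS; field; rewrite ?expf_neq0 ?gt_eqF.
rewrite ler_wpM2l// -/r.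
have n0 : 0 < 2 ^+ n :> R by exact: exprn_gt0.
rewrite ler_pdivrMr ?exprn_gt0// ler_pdivlMl ?exprn_gt0//.
rewrite exprS (_ : _ * _ = 2 ^+ n * 2 ^+ n); last by field.
by rewrite -exprD ler_eXn2l ?ltr1n// addnn -muln2 leq_mul.
Qed.

(** Two points of [D] are at distance less than twice the radius of a ball around 0 containing [D],
    so one pointwise bound on [Phi] covers all [x] in [D]; this uniformity is what Schur's test
    consumes. *)
Lemma integral_Phi_le (R : realType) d k (D : set 'rV[R]_d) :
  d = 2%N \/ d = 3%N -> 0 < k -> measurable D -> bounded_set D ->
  exists2 M : R, 0 < M & forall x, D x ->
    (\int[leb R d]_(y in D) (cnorm (Phi k (x - y)))%:E <= M%:E)%E.
Proof.
move=> hd k0 mD bD; have [r r0 Dr] := bounded_setP_lt bD.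
have [C C0 HC] := Phi_le (2 * r) hd k0.
have Doo := leb_bounded_lty mD bD.
have r20 : 0 < 2 * r by rewrite mulr_gt0.
have d2 : (2 <= d)%N by case: hd => ->.
have [M M0 HM] := integral_inv_norm_le d2 mD Doo r20 (ltW C0) (cnorm_ge0 (@Phi R d k 0)).
exists M => // x Dx; apply: HM => [|y Dy|y _|_|y Dy yx].
- have [mr mi] := measurable_Phi k hd.
  apply: measurable_funTS; apply: measurable_cnorm.
    exact: (measurableT_comp mr (measurable_rV_subl x)).
  exact: (measurableT_comp mi (measurable_rV_subl x)).
- by rewrite (le_lt_trans (ler_normB _ _))//; have := Dr _ Dx; have := Dr _ Dy; lra.
- exact: cnorm_ge0.
- by rewrite subrr.
- apply: HC; first by rewrite subr_eq0 eq_sym.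
  by rewrite (le_trans (ler_normB _ _))//; have := Dr _ Dx; have := Dr _ Dy; lra.
Qed.

(** * Lebesgue spaces of complex functions *)

(** The norm with exponent [+oo] unfolds to an essential supremum only when the whole space has
    positive measure. *)
Lemma leb_setT_gt0 (R : realType) d : (0 < leb R d setT)%E.
Proof.
apply: (@lt_le_trans _ _ (leb R d (cube 0 1))).
  by rewrite leb_cube// lte_fin mulr1 exprn_gt0.
by apply: le_measure; rewrite ?inE//; exact: measurable_cube.
Qed.

(** * Sequences with geometrically decreasing increments *)

Section geometric_increments.
Context {R : realType}.

(** The function [N] is left abstract so that the estimate applies both to the absolute value on [R]
    and to the real-valued modulus [cnorm]. *)
Lemma ler_geometric_increments (V : zmodType) (N : V -> R) (a : nat -> V) (c : R) :
  N 0 = 0 -> (forall x y, N (x + y) <= N x + N y) -> (forall x, 0 <= N x) ->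
  (forall x, N (- x) = N x) ->
  (forall i, N (a i.+1 - a i) <= c / 2 ^+ i) ->
  forall i m, (i <= m)%N -> N (a i - a m) <= 2 * c / 2 ^+ i.
Proof.
move=> N0 ND Nge0 NN H.
have c0 : 0 <= c by have := H 0%N; rewrite expr0 divr1; exact: le_trans.
(* Keeping the exact tail of the geometric sum makes the induction on [j] go through. *)
suff K i j : N (a i - a (i + j)%N) <= 2 * c / 2 ^+ i - 2 * c / 2 ^+ (i + j).
  move=> i m im; have := K i (m - i)%N; rewrite subnKC// => /le_trans; apply.
  by rewrite gerBl divr_ge0// mulr_ge0.
elim: j => [|j ih]; first by rewrite addn0 !subrr N0.
rewrite addnS -(subrKA (a (i + j)%N)).
apply: (le_trans (ND _ _)); rewrite -[X in _ + N X]opprB NN.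
apply: (le_trans (lerD ih (H _))).
rewrite exprS (_ : 2 * c / (2 * _) = c / 2 ^+ (i + j)); last first.
  by field; rewrite expf_neq0.
by rewrite le_eqVlt; apply/orP; left; apply/eqP; field; rewrite !expf_neq0.
Qed.

Lemma geometric_vanish (c e : R) : 0 < e -> \forall n \near \oo, c / 2 ^+ n < e.
Proof.
move=> e0; have : (fun i : nat => c / 2 ^+ i) @ \oo --> (0 : R).
  rewrite -(mulr0 c); under eq_fun do rewrite -exprVn.
  by apply: cvgMr; apply: cvg_expr; rewrite ger0_norm ?invr_ge0// invf_lt1//; lra.
move=> /cvgrPdist_lt /(_ _ e0); apply: filterS => n.
by rewrite sub0r normrN; apply: le_lt_trans; exact: ler_norm.
Qed.

Lemma cvg_geometric_increments (a : R^nat) (c : R) :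
  (forall i, `|a i.+1 - a i| <= c / 2 ^+ i) ->
  exists2 l : R, a @ \oo --> l & forall i, `|a i - l| <= 2 * c / 2 ^+ i.
Proof.
move=> H; have K := ler_geometric_increments (@normr0 _ R) (@ler_normD _ R)
  (@normr_ge0 _ R) (@normrN _ R) H.
have ca : cvgn a.
  apply/cauchy_cvgP/cauchy_ballP => e e0; rewrite near_map2.
  have e20 : 0 < e / 2 by rewrite divr_gt0.
  have [N _ /(_ N (leqnn N)) HN] := geometric_vanish (2 * c) e20.
  exists ([set n | (N <= n)%N], [set n | (N <= n)%N]); first by split; exists N.
  move=> [i j] /= [Ni Nj]; rewrite /ball/= -(subrKA (a N)).
  rewrite (le_lt_trans (ler_normD _ _))// [X in X + _]distrC (splitr e).
  by apply: ltrD; apply: le_lt_trans HN; exact: K.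
exists (limn a) => // i; apply/ler_addgt0Pr => e e0.
have [m [im Hm]] : exists m, (i <= m)%N /\ `|limn a - a m| < e.
  have /cvgrPdist_lt /(_ _ e0)[N _ HN] : a @ \oo --> limn a by [].
  exists (maxn i N); split; first exact: leq_maxl.
  by apply: HN; exact: leq_maxr.
rewrite -(subrKA (a m)) (le_trans (ler_normD _ _))// lerD ?K// distrC.
exact: ltW.
Qed.

End geometric_increments.

Section Lpnorm.
Context {R : realType} {d : nat}.
Implicit Types (D : set 'rV[R]_d) (f g : 'rV[R]_d -> R[i]) (p : \bar R).

Definition Lp_exponent p := p = 2%:E \/ p = +oo%E.

Definition measurable_on D f := measurable_fun D (fun x => complex.Re (f x)) /\
  measurable_fun D (fun x => complex.Im (f x)).

Lemma measurable_on_cnorm D f : measurable_on D f -> measurable_fun D (fun x => cnorm (f x)).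
Proof. by case=> *; exact: measurable_cnorm. Qed.

Lemma measurable_on_restrict D f : measurable D -> measurable_on D f ->
  measurable_fun setT ((fun x => cnorm (f x)) \_ D).
Proof. by move=> mD /measurable_on_cnorm /(measurable_restrictT _ mD). Qed.

Lemma measurable_on_cst D (c : R[i]) : measurable_on D (fun=> c).
Proof. by split; exact: measurable_cst. Qed.

Lemma measurable_onD D f g : measurable_on D f -> measurable_on D g ->
  measurable_on D (fun x => f x + g x).
Proof.
move=> [fr fi] [gr gi]; split.
  by under eq_fun do rewrite ReD; exact: measurable_funD.
by under eq_fun do rewrite ImD; exact: measurable_funD.
Qed.

Lemma measurable_onM D f g : measurable_on D f -> measurable_on D g ->
  measurable_on D (fun x => f x * g x).
Proof.
move=> [fr fi] [gr gi]; split.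
  by under eq_fun do rewrite ReM; apply: measurable_funB; exact: measurable_funM.
by under eq_fun do rewrite ImM; apply: measurable_funD; exact: measurable_funM.
Qed.

Lemma measurable_onB D f g : measurable_on D f -> measurable_on D g ->
  measurable_on D (fun x => f x - g x).
Proof.
move=> [fr fi] [gr gi]; split.
  by under eq_fun do rewrite ReD ReN; exact: measurable_funB.
by under eq_fun do rewrite ImD ImN; exact: measurable_funB.
Qed.

Lemma measurable_on_real D (f : 'rV[R]_d -> R) : measurable_fun D f ->
  measurable_on D (fun x => (f x)%:C).
Proof. by move=> mf; split => //; exact: measurable_cst. Qed.

Lemma LpP p D f : Lp p D f <-> measurable_on D f /\ (Lpnorm p D f < +oo)%E.
Proof. by split=> [[]|[[]]]. Qed.

Lemma Lpnorm_ge0 p D f : (0 <= Lpnorm p D f)%E.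
Proof. exact: Lnorm_ge0. Qed.

Lemma Lpnorm2E D f :
  Lpnorm 2%:E D f = ((\int[leb R d]_(x in D) ((cnorm (f x) ^+ 2)%:E)) `^ 2^-1)%E.
Proof.
rewrite /Lpnorm unlock [in RHS]integral_mkcond; congr (_ `^ _)%E.
apply: eq_integral => x _; rewrite !patchE; case: ifPn => xD.
  by rewrite /= ger0_norm ?cnorm_ge0// powR_mulrn// cnorm_ge0.
by rewrite /= normr0 powR0// pnatr_eq0.
Qed.


Lemma Lpnorm_restrictE p D f :
  Lpnorm p D f = 'N[leb R d]_p[EFin \o ((fun x => cnorm (f x)) \_ D)]%E.
Proof. by rewrite /Lpnorm -restrict_EFin. Qed.

Lemma Lpnormy_ge D f :
  {ae leb R d, forall x, D x -> ((cnorm (f x))%:E <= Lpnorm +oo D f)%E}.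
Proof.
rewrite /Lpnorm unlock leb_setT_gt0.
set h := (X in ess_sup _ X).
apply: filterS (ess_sup_ge (leb R d) h) => x + Dx; apply: le_trans.
by rewrite /h /= patchE mem_set//= ger0_norm// cnorm_ge0.
Qed.

Lemma Lpnormy_leP D f (c : R) : 0 <= c ->
  (Lpnorm +oo D f <= c%:E)%E <-> {ae leb R d, forall x, D x -> cnorm (f x) <= c}.
Proof.
move=> c0; split=> H.
  apply: filterS (Lpnormy_ge D f) => x /[apply] fx.
  by rewrite -lee_fin (le_trans fx).
rewrite /Lpnorm unlock leb_setT_gt0; apply/ess_supP.
apply: filterS H => x Hx; rewrite /= patchE; case: ifPn => xD.
  by rewrite /= lee_fin ger0_norm ?cnorm_ge0// Hx// -in_setE.
by rewrite /= normr0 lee_fin.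
Qed.

(** Pointwise estimates pass to both norms through this lemma alone: [c = 1] gives monotonicity and
    invariance under equality almost everywhere, [c = 0] the vanishing of the norm of a null
    function. *)
Lemma le_Lpnorm_scale p D f g (c : R) : Lp_exponent p -> measurable D ->
  0 <= c -> measurable_on D f -> measurable_on D g ->
  {ae leb R d, forall x, D x -> cnorm (f x) <= c * cnorm (g x)} ->
  (Lpnorm p D f <= c%:E * Lpnorm p D g)%E.
Proof.
move=> [] -> mD c0 mf mg fg.
  rewrite !Lpnorm2E.
  have sq h : measurable_on D h -> measurable_fun D (fun x => (cnorm (h x) ^+ 2)%:E).
    by move=> mh; apply/measurable_EFinP/measurable_funX; exact: measurable_on_cnorm.
  rewrite -[c in X in (_ <= X)%E](_ : (c ^+ 2) `^ 2^-1 = c); last first.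
    by rewrite -powR_mulrn// -powRrM mulfV// powRr1.
  rewrite -poweR_EFin -poweRM ?lee_fin ?sqr_ge0//; last first.
    by apply: integral_ge0 => x _; rewrite lee_fin sqr_ge0.
  rewrite -ge0_integralZl_EFin ?sqr_ge0//; last 2 first.
  - by move=> x _; rewrite lee_fin sqr_ge0.
  - exact: sq.
  apply: gt0_ler_poweR; rewrite ?invr_ge0// ?in_itv/= ?leey ?andbT.
  - by apply: integral_ge0 => x _; rewrite lee_fin sqr_ge0.
  - by apply: integral_ge0 => x _; rewrite -EFinM lee_fin mulr_ge0 ?sqr_ge0.
  apply: ae_ge0_le_integral => //.
  - by move=> x _; rewrite lee_fin sqr_ge0.
  - exact: sq.
  - by move=> x _; rewrite -EFinM lee_fin mulr_ge0 ?sqr_ge0.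
  - by apply: measurable_funeM; exact: sq.
  apply: filterS fg => x /[apply] fgx.
  by rewrite -EFinM lee_fin -exprMn ler_pXn2r ?nnegrE ?mulr_ge0 ?cnorm_ge0.
have H := Lpnormy_ge D g.
rewrite {1}/Lpnorm unlock leb_setT_gt0; apply/ess_supP.
apply: filterS2 fg H => x fx gx; rewrite /= patchE; case: ifPn => xD.
  have Dx : D x by rewrite -in_setE.
  rewrite /= ger0_norm ?cnorm_ge0//.
  apply: (@le_trans _ _ (c%:E * (cnorm (g x))%:E)%E); first by rewrite -EFinM lee_fin fx.
  by apply: lee_wpmul2l; rewrite ?lee_fin// gx.
by rewrite /= normr0 mule_ge0// Lpnorm_ge0.
Qed.

Lemma le_Lpnorm p D f g : Lp_exponent p -> measurable D ->
  measurable_on D f -> measurable_on D g ->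
  {ae leb R d, forall x, D x -> cnorm (f x) <= cnorm (g x)} ->
  (Lpnorm p D f <= Lpnorm p D g)%E.
Proof.
move=> hp mD mf mg fg; rewrite -[leRHS]mul1e; apply: le_Lpnorm_scale => //.
by apply: filterS fg => x /[apply]; rewrite mul1r.
Qed.

Lemma eq_Lpnorm p D f g : Lp_exponent p -> measurable D ->
  measurable_on D f -> measurable_on D g ->
  f = g %[ae leb R d in D] -> Lpnorm p D f = Lpnorm p D g.
Proof.
move=> hp mD mf mg fg; apply/eqP; rewrite eq_le !le_Lpnorm//;
  by apply: filterS fg => x /[apply] ->.
Qed.

(** Minkowski's inequality is applied to the real functions [|f|] and [|g|]; their sum, viewed as
    the complex function [h], dominates [f + g]. *)
Lemma LpnormD p D f g : Lp_exponent p -> measurable D ->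
  measurable_on D f -> measurable_on D g ->
  (Lpnorm p D (fun x => f x + g x)%R <= Lpnorm p D f + Lpnorm p D g)%E.
Proof.
move=> hp mD mf mg; have p1 : (1 <= p)%E by case: hp => -> //; rewrite ?leey// lee_fin ler1n.
rewrite [in leRHS]Lpnorm_restrictE [X in (_ + X)%E]Lpnorm_restrictE.
apply: le_trans; last by apply: eminkowski => //; exact: measurable_on_restrict.
pose h x : R[i] := (cnorm (f x) + cnorm (g x))%:C.
have hE x : cnorm (h x) = cnorm (f x) + cnorm (g x).
  by rewrite /h cnorm_real ger0_norm// addr_ge0 ?cnorm_ge0.
rewrite [leRHS](_ : _ = Lpnorm p D h); last first.
  rewrite Lpnorm_restrictE; rewrite (funext hE).
  by apply: eq_Lnorm => x; rewrite /= !patchE; case: ifP => _; rewrite ?addr0.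
apply: le_Lpnorm => //; first exact: measurable_onD.
  by apply: measurable_on_real; apply: measurable_funD; exact: measurable_on_cnorm.
by apply: aeW => x _; rewrite hE ler_cnormD.
Qed.

Lemma LpnormB p D f g : Lp_exponent p -> measurable D ->
  measurable_on D f -> measurable_on D g ->
  (Lpnorm p D (fun x => f x - g x)%R <= Lpnorm p D f + Lpnorm p D g)%E.
Proof.
move=> hp mD mf mg; have mgN : measurable_on D (fun x => - g x).
  by have := measurable_onB (measurable_on_cst D 0) mg; under eq_fun do rewrite sub0r.
apply: (le_trans (LpnormD hp mD mf mgN)); apply: leeD => //.
by apply: le_Lpnorm => //; apply: aeW => x _; rewrite cnormN.
Qed.

Lemma Lpnorm_eq0 p D f : Lp_exponent p -> measurable D -> measurable_on D f ->
  Lpnorm p D f = 0 -> f = cst 0 %[ae leb R d in D].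
Proof.
move=> hp mD mf f0; have p0 : (0 < p)%E by case: hp => ->.
rewrite Lpnorm_restrictE in f0.
have [|N] := Lnorm_eq0_eq0 _ p0 f0.
  by apply/measurable_EFinP; exact: measurable_on_restrict.
move=> [mN N0 H]; exists N; split => // x Hx; apply: H => /= xH; apply: Hx => Dx.
have := xH I; rewrite /= patchE mem_set//= => -[]; exact: cnorm_eq0.
Qed.

Lemma Lpnorm_ae0 p D f : Lp_exponent p -> measurable D -> measurable_on D f ->
  f = cst 0 %[ae leb R d in D] -> Lpnorm p D f = 0.
Proof.
move=> hp mD mf f0; apply/eqP; rewrite eq_le Lpnorm_ge0 andbT -(mul0e (Lpnorm p D f)).
apply: le_Lpnorm_scale => //; apply: filterS f0 => x /[apply] ->.
by rewrite mul0r cnorm0.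
Qed.

Lemma LpB p D f g : Lp_exponent p -> measurable D -> Lp p D f -> Lp p D g ->
  Lp p D (fun x => f x - g x).
Proof.
move=> hp mD /LpP[mf fp] /LpP[mg gp]; apply/LpP; split; first exact: measurable_onB.
by apply: (le_lt_trans (LpnormB hp mD mf mg)); exact: lte_add_pinfty.
Qed.

(** A bounded function is dominated by a multiple of the constant 1, which is square integrable on a
    set of finite measure. *)
Lemma Lpy_sub_Lp2 D f : measurable D -> (leb R d D < +oo)%E ->
  Lp +oo D f -> Lp 2%:E D f.
Proof.
move=> mD Doo /LpP[mf fy]; apply/LpP; split => //.
have fN : Lpnorm +oo D f \is a fin_num by rewrite ge0_fin_numE// Lpnorm_ge0.
have c0 : 0 <= fine (Lpnorm +oo D f) by rewrite fine_ge0// Lpnorm_ge0.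
have H : (Lpnorm 2%:E D f <= (fine (Lpnorm +oo D f))%:E * Lpnorm 2%:E D (fun=> 1%R))%E.
  apply: le_Lpnorm_scale => //; first by left.
  apply: filterS (Lpnormy_ge D f) => x /[apply].
  by rewrite -{1}(fineK fN) lee_fin /cnorm Normc.normc1 mulr1.
apply: (le_lt_trans H); rewrite lte_mul_pinfty ?lee_fin//; rewrite Lpnorm2E poweR_lty//.
rewrite /cnorm; under eq_integral do rewrite Normc.normc1 expr1n.
by rewrite integral_cst// mul1e.
Qed.

Lemma Linfty_complete D (u : nat -> 'rV[R]_d -> R[i]) (c : R) : measurable D ->
  (forall i, Lp +oo D (u i)) ->
  (forall i, (Lpnorm +oo D (fun x => u i.+1 x - u i x)%R <= (c / 2 ^+ i)%:E)%E) ->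
  exists2 l, Lp +oo D l & forall i,
    (Lpnorm +oo D (fun x => u i x - l x)%R <= (2 * c / 2 ^+ i)%:E)%E.
Proof.
move=> mD Lu du.
have c0 : 0 <= c.
  by have := le_trans (Lpnorm_ge0 _ _ _) (du 0%N); rewrite lee_fin expr0 divr1.
have ci0 i : 0 <= c / 2 ^+ i by rewrite divr_ge0 ?exprn_ge0.
have incr : {ae leb R d, forall x, forall i, D x -> cnorm (u i.+1 x - u i x) <= c / 2 ^+ i}.
  by apply: ae_foralln => i; apply/Lpnormy_leP.
(* the limit superior is measurable everywhere, while [u] converges only almost
   everywhere *)
pose lr x := fine (limn_esup (fun n => (complex.Re (u n x))%:E)).
pose li x := fine (limn_esup (fun n => (complex.Im (u n x))%:E)).
pose l x := lr x +i* li x.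
have ml : measurable_on D l.
  split; apply: (measurableT_comp (fine_measurable _)) => //;
    apply: measurable_fun_limn_esup => n; apply/measurable_EFinP; by case: (Lu n).
have limE (a : R^nat) : (forall i, `|a i.+1 - a i| <= c / 2 ^+ i) ->
    forall i, `|a i - fine (limn_esup (fun n => (a n)%:E))| <= 2 * c / 2 ^+ i.
  move=> /cvg_geometric_increments[b ab Hb] i.
  have abE : (fun n => (a n)%:E) @ \oo --> b%:E by apply: cvg_EFin => //; exact: nearW.
  rewrite is_cvg_limn_esupE; last by apply/cvg_ex; exists b%:E.
  by rewrite (cvg_lim _ abE).
have ul i : (Lpnorm +oo D (fun x => u i x - l x)%R <= (2 * c / 2 ^+ i)%:E)%E.
  apply/Lpnormy_leP; first by rewrite -mulrA mulr_ge0.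
  apply: filterS incr => x Hx Dx; apply/ler_addgt0Pr => e e0.
  have {}Hx j := Hx j Dx.
  have Hr j : `|complex.Re (u j.+1 x) - complex.Re (u j x)| <= c / 2 ^+ j.
    by rewrite -ReN -ReD (le_trans (normr_Re_le _)).
  have Hi j : `|complex.Im (u j.+1 x) - complex.Im (u j x)| <= c / 2 ^+ j.
    by rewrite -ImN -ImD (le_trans (normr_Im_le _)).
  have e20 : 0 < e / 2 by rewrite divr_gt0.
  have [N _ /(_ (maxn i N) (leq_maxr _ _)) HN] := geometric_vanish (2 * c) e20.
  set m := maxn i N in HN.
  (* Passing to the limit in real and imaginary parts separately would double the bound. The detour
     through [u m x] keeps the rate for the modulus and leaves only an error [e] to the two
     parts. *)
  rewrite -(subrKA (u m x)) (le_trans (ler_cnormD _ _))//; apply: lerD.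
    exact: (@ler_geometric_increments R R[i] (@cnorm R) (u ^~ x) c (@cnorm0 R)
      (@ler_cnormD R) (@cnorm_ge0 R) (@cnormN R) Hx i m (leq_maxl _ _)).
  apply: (le_trans (cnorm_le_ReIm _)); rewrite (splitr e) ReD ImD ReN ImN.
  by apply: lerD; apply: ltW; apply: le_lt_trans HN; [exact: limE Hr m|exact: limE Hi m].
exists l => //; apply/LpP; split => //.
(* The limit is essentially bounded because [u 0] and [u 0 - l] are. *)
apply: (@le_lt_trans _ _ (Lpnorm +oo D (fun x => u 0 x - (u 0 x - l x))%R)).
  apply: le_Lpnorm => //; first by right.
    by case/LpP: (Lu 0%N) => m0 _; do 2 apply: measurable_onB => //.
  by apply: aeW => x _; rewrite subKr.
case/LpP: (Lu 0%N) => m0 u0.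
apply: (le_lt_trans (LpnormB _ mD m0 (measurable_onB m0 ml))); first by right.
by apply: lte_add_pinfty => //; apply: (le_lt_trans (ul 0%N)); rewrite ltry.
Qed.

End Lpnorm.

(** * The volume potential *)

Lemma measurable_rV_sub (R : realType) d :
  measurable_fun setT (fun z : 'rV[R]_d * 'rV[R]_d => z.1 - z.2).
Proof.
apply/measurable_fun_rVP => i.
rewrite (_ : _ \o _ = (fun z => rV_coord i z.1 - rV_coord i z.2)); last first.
  by apply/funext => z; rewrite /= /rV_coord !mxE.
by apply: measurable_funB; apply: (measurableT_comp (measurable_rV_coord i)).
Qed.

Lemma measurable_integral_leb (R : realType) d d' (T : measurableType d')
    (g : T * 'rV[R]_d -> \bar R) : measurable_fun setT g ->
  (forall z, 0 <= g z)%E ->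
  measurable_fun setT (fun x : T => \int[leb R d]_y g (x, y))%E.
Proof.
move=> mg g0.
exact: (measurable_fun_fubini_tonelli_F (m2 := @sfleb R d) g mg g0).
Qed.

(** Tonelli's theorem handles the positive and negative parts separately; their extended-real
    difference and its [fine] part stay measurable even at points where both are infinite. *)
Lemma measurable_Rintegral_leb (R : realType) d d' (T : measurableType d')
    (f : T * 'rV[R]_d -> R) : measurable_fun setT f ->
  measurable_fun setT (fun x : T => fine (\int[leb R d]_y (f (x, y))%:E)%E).
Proof.
move=> mf; apply: (measurableT_comp (fine_measurable _)) => //.
have mfe : measurable_fun setT (EFin \o f) by exact/measurable_EFinP.
under eq_fun do rewrite integralE.
apply: emeasurable_funB.
  under eq_fun do under eq_integral do rewrite unlock.
  apply: (@measurable_integral_leb R d _ T (fun z => maxe (f z)%:E 0)%E).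
    exact: measurable_maxe.
  by move=> z; rewrite le_max lexx orbT.
under eq_fun do under eq_integral do rewrite unlock.
apply: (@measurable_integral_leb R d _ T (fun z => maxe (- (f z)%:E) 0)%E).
  by apply: measurable_maxe => //; exact: measurableT_comp.
by move=> z; rewrite le_max lexx orbT.
Qed.

Section potential.
Context {R : realType} {d : nat} (k : R) (D : set 'rV[R]_d).
Hypotheses (hd : d = 2%N \/ d = 3%N) (mD : measurable D).
Implicit Types (h g : 'rV[R]_d -> R[i]) (x y : 'rV[R]_d).

Let K x y := cnorm (Phi k (x - y)).

Lemma measurable_on_Phi x : measurable_on D (fun y => Phi k (x - y)).
Proof.
have [mr mi] := measurable_Phi k hd.
split; apply: measurable_funTS.
  exact: (measurableT_comp mr (measurable_rV_subl x)).
exact: (measurableT_comp mi (measurable_rV_subl x)).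
Qed.

Lemma measurable_potential h : measurable_on D h -> measurable_on D (potential k D h).
Proof.
move=> [hr hi].
have [mr mi] := measurable_Phi k hd.
have msub (u : 'rV[R]_d -> R) : measurable_fun setT u ->
    measurable_fun setT (fun z : 'rV[R]_d * 'rV[R]_d => u (z.1 - z.2)).
  by move=> mu; apply: (measurableT_comp mu); exact: measurable_rV_sub.
have mD2 (u : 'rV[R]_d -> R) : measurable_fun D u ->
    measurable_fun setT (fun z : 'rV[R]_d * 'rV[R]_d => (u \_ D) z.2).
  by move=> /(measurable_restrictT _ mD) mu; exact: (measurableT_comp mu).
split; apply: measurable_funTS; rewrite /potential /cintegral /=;
    under eq_fun do rewrite Rintegral_mkcond.
- apply: (@measurable_Rintegral_leb R d _ 'rV[R]_d (fun z =>
    ((fun y => complex.Re (Phi k (z.1 - y) * h y)) \_ D) z.2)).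
  rewrite (_ : (fun _ => _) = (fun z : 'rV[R]_d * 'rV[R]_d =>
    complex.Re (Phi k (z.1 - z.2)) * ((fun y => complex.Re (h y)) \_ D) z.2 -
    complex.Im (Phi k (z.1 - z.2)) * ((fun y => complex.Im (h y)) \_ D) z.2)).
    by apply: measurable_funB; apply: measurable_funM;
      solve [exact: (msub _ mr)|exact: (msub _ mi)|exact: (mD2 _ hr)|exact: (mD2 _ hi)].
  apply/funext => z; rewrite !patchE; case: ifP => _; first by rewrite ReM.
  by rewrite !mulr0 subrr.
- apply: (@measurable_Rintegral_leb R d _ 'rV[R]_d (fun z =>
    ((fun y => complex.Im (Phi k (z.1 - y) * h y)) \_ D) z.2)).
  rewrite (_ : (fun _ => _) = (fun z : 'rV[R]_d * 'rV[R]_d =>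
    complex.Re (Phi k (z.1 - z.2)) * ((fun y => complex.Im (h y)) \_ D) z.2 +
    complex.Im (Phi k (z.1 - z.2)) * ((fun y => complex.Re (h y)) \_ D) z.2)).
    by apply: measurable_funD; apply: measurable_funM;
      solve [exact: (msub _ mr)|exact: (msub _ mi)|exact: (mD2 _ hr)|exact: (mD2 _ hi)].
  apply/funext => z; rewrite !patchE; case: ifP => _; first by rewrite ImM.
  by rewrite !mulr0 addr0.
Qed.

(** The factor 2 arises because the complex integral is defined by components: the real and the
    imaginary part are each bounded by the integral of the modulus. *)
Lemma cnorm_potential_le h x : measurable_on D h ->
  ((cnorm (potential k D h x))%:E <=
   2%:E * \int[leb R d]_(y in D) (K x y * cnorm (h y))%:E)%E.
Proof.
move=> mh; have [fr fi] := measurable_onM (measurable_on_Phi x) mh.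
have mc := measurable_on_cnorm (measurable_onM (measurable_on_Phi x) mh).
have part (f : 'rV[R]_d -> R) : measurable_fun D f ->
    (forall y, `|f y| <= cnorm (Phi k (x - y) * h y)) ->
    (`|\int[leb R d]_(y in D) f y|%:E <=
     \int[leb R d]_(y in D) (K x y * cnorm (h y))%:E)%E.
  move=> mf fle; have mfe : measurable_fun D (EFin \o f) by exact/measurable_EFinP.
  (* If the extended integral is infinite, the real-valued one is 0 by convention and the inequality
     still holds. *)
  apply: (@le_trans _ _ (`|\int[leb R d]_(y in D) (f y)%:E|)%E).
    by rewrite /Rintegral; case: (\int[leb R d]_(y in D) (f y)%:E)%E => [r||]//=;
      rewrite normr0 leey.
  apply: (le_trans (le_abse_integral _ _ _)) => //.
  apply: ge0_le_integral => //.
  - exact: measurableT_comp.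
  - by under eq_fun do rewrite -cnormM; exact/measurable_EFinP.
  - by move=> y _; rewrite lee_fin -cnormM.
rewrite [leRHS](_ : _ = \int[leb R d]_(y in D) (K x y * cnorm (h y))%:E +
    \int[leb R d]_(y in D) (K x y * cnorm (h y))%:E)%E; last by rewrite mule_natl mule2n.
apply: (@le_trans _ _ (`|complex.Re (potential k D h x)| +
  `|complex.Im (potential k D h x)|)%:E); first by rewrite lee_fin cnorm_le_ReIm.
rewrite EFinD; apply: leeD; apply: part => // y.
  exact: normr_Re_le.
exact: normr_Im_le.
Qed.

Definition kernel_bound (M : R) := 0 < M /\
  forall x, D x -> (\int[leb R d]_(y in D) (K x y)%:E <= M%:E)%E.

Lemma measurable_kernelM x (f : 'rV[R]_d -> R) : measurable_fun D f ->
  measurable_fun D (fun y => (K x y * f y)%:E).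
Proof.
move=> mf; apply/measurable_EFinP; apply: measurable_funM => //.
exact: measurable_on_cnorm (measurable_on_Phi x).
Qed.

Lemma integral_kernel_le M x (f : 'rV[R]_d -> R) (c : R) : kernel_bound M -> D x ->
  0 <= c -> measurable_fun D f -> (forall y, 0 <= f y) ->
  {ae leb R d, forall y, D y -> f y <= c} ->
  (\int[leb R d]_(y in D) (K x y * f y)%:E <= (c * M)%:E)%E.
Proof.
move=> [M0 HM] Dx c0 mf f0 fc.
have mK : measurable_fun D (fun y => (K x y)%:E).
  by apply/measurable_EFinP; exact: measurable_on_cnorm (measurable_on_Phi x).
apply: (@le_trans _ _ (\int[leb R d]_(y in D) (c%:E * (K x y)%:E))%E).
  apply: ae_ge0_le_integral => //.
  - by move=> y _; rewrite lee_fin mulr_ge0 ?cnorm_ge0.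
  - exact: measurable_kernelM.
  - by move=> y _; rewrite -EFinM lee_fin mulr_ge0 ?cnorm_ge0.
  - exact: measurable_funeM.
  apply: filterS fc => y /[apply] fy; rewrite -EFinM lee_fin mulrC.
  by apply: ler_wpM2r => //; exact: cnorm_ge0.
rewrite ge0_integralZl_EFin//; last by move=> y _; rewrite lee_fin cnorm_ge0.
by rewrite EFinM lee_wpmul2l ?lee_fin// HM.
Qed.

Lemma Lpy_ae_bound h : Lp +oo D h ->
  {ae leb R d, forall x, D x -> cnorm (h x) <= fine (Lpnorm +oo D h)}.
Proof.
move=> [mr mi hy]; apply/Lpnormy_leP; first by rewrite fine_ge0// Lpnorm_ge0.
by rewrite fineK// ge0_fin_numE// Lpnorm_ge0.
Qed.

Lemma integrable_Phi_mul M h x : kernel_bound M -> D x -> Lp +oo D h ->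
  (leb R d).-integrable D (fun y => (complex.Re (Phi k (x - y) * h y))%:E) /\
  (leb R d).-integrable D (fun y => (complex.Im (Phi k (x - y) * h y))%:E).
Proof.
move=> hM Dx Lh; have [mh _] := (LpP _ _ _).1 Lh.
have mc := measurable_on_cnorm mh.
have mPh := measurable_onM (measurable_on_Phi x) mh.
have c0 : 0 <= fine (Lpnorm +oo D h) by rewrite fine_ge0// Lpnorm_ge0.
have : (leb R d).-integrable D (fun y => (cnorm (Phi k (x - y) * h y))%:E).
  apply/integrableP; split; first by apply/measurable_EFinP; exact: measurable_on_cnorm.
  under eq_integral do rewrite gee0_abs ?lee_fin ?cnorm_ge0// cnormM.
  apply: le_lt_trans (integral_kernel_le hM Dx c0 mc _ (Lpy_ae_bound Lh)) _.
    by move=> y; exact: cnorm_ge0.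
  by rewrite ltry.
move=> ci; split; apply: le_integrable ci => //.
- by apply/measurable_EFinP; case: mPh.
- by move=> y _; rewrite lee_fin (ger0_norm (cnorm_ge0 _)) normr_Re_le.
- by apply/measurable_EFinP; case: mPh.
- by move=> y _; rewrite lee_fin (ger0_norm (cnorm_ge0 _)) normr_Im_le.
Qed.

Lemma potentialB M g h x : kernel_bound M -> D x -> Lp +oo D g -> Lp +oo D h ->
  potential k D (fun y => g y - h y) x = potential k D g x - potential k D h x.
Proof.
move=> hM Dx Lg Lh.
have [gr gi] := integrable_Phi_mul hM Dx Lg.
have [hr hi] := integrable_Phi_mul hM Dx Lh.
rewrite /potential /cintegral; apply: complex_eqP.
  rewrite ReD ReN /= -RintegralB//.
  by apply: eq_Rintegral => y _; rewrite mulrBr ReD ReN.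
rewrite ImD ImN /= -RintegralB//.
by apply: eq_Rintegral => y _; rewrite mulrBr ImD ImN.
Qed.

Lemma Lpnormy_potential_le M h : kernel_bound M -> Lp +oo D h ->
  (Lpnorm +oo D (potential k D h) <= (2 * M)%:E * Lpnorm +oo D h)%E.
Proof.
move=> hM Lh; have [mh hy] := (LpP _ _ _).1 Lh; have [M0 _] := hM.
have hN : Lpnorm +oo D h \is a fin_num by rewrite ge0_fin_numE// Lpnorm_ge0.
have c0 : 0 <= fine (Lpnorm +oo D h) by rewrite fine_ge0// Lpnorm_ge0.
have c20 : 0 <= 2 * M * fine (Lpnorm +oo D h) by rewrite !mulr_ge0// ltW.
rewrite -(fineK hN) -EFinM; apply/Lpnormy_leP => //; apply: aeW => x Dx.
rewrite -lee_fin (le_trans (cnorm_potential_le x mh))//.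
rewrite -mulrA EFinM lee_wpmul2l ?lee_fin// mulrC.
apply: integral_kernel_le => //; first exact: measurable_on_cnorm.
  by move=> y; exact: cnorm_ge0.
exact: Lpy_ae_bound.
Qed.

Lemma kernelC x y : K x y = K y x.
Proof. by rewrite /K -PhiN opprB. Qed.

(* Cauchy-Schwarz: integrate [2 t f <= t^2 + f^2] against [K x] and take
   [t = (\int K f) / M]. *)
Lemma sqr_integral_kernel_le M x (f : 'rV[R]_d -> R) (c : R) : kernel_bound M -> D x ->
  0 <= c ->  measurable_fun D f -> (forall y, 0 <= f y) ->
  {ae leb R d, forall y, D y -> f y <= c} ->
  (\int[leb R d]_(y in D) (K x y * f y)%:E * \int[leb R d]_(y in D) (K x y * f y)%:E <=
   M%:E * \int[leb R d]_(y in D) (K x y * f y ^+ 2)%:E)%E.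
Proof.
move=> hM Dx c0 mf f0 fc; have [M0 HM] := hM.
have K0 y : 0 <= K x y by exact: cnorm_ge0.
have mf2 : measurable_fun D (fun y => f y ^+ 2) by exact: measurable_funX.
have f20 y : 0 <= f y ^+ 2 by exact: sqr_ge0.
have fc2 : {ae leb R d, forall y, D y -> f y ^+ 2 <= c ^+ 2}.
  apply: filterS fc => y /[apply] fy; rewrite ler_pXn2r ?nnegrE//.
(* The bound [c] makes both integrals finite, so that the rest is arithmetic in [R]; it does not
   enter the final constant. *)
have IM := integral_kernel_le hM Dx c0 mf f0 fc.
have JM := integral_kernel_le hM Dx (sqr_ge0 c) mf2 f20 fc2.
set I := (\int[leb R d]_(y in D) (K x y * f y)%:E)%E in IM *.
set J := (\int[leb R d]_(y in D) (K x y * f y ^+ 2)%:E)%E in JM *.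
have I0 : (0 <= I)%E by apply: integral_ge0 => y _; rewrite lee_fin mulr_ge0.
have J0 : (0 <= J)%E by apply: integral_ge0 => y _; rewrite lee_fin mulr_ge0.
have If : I \is a fin_num by rewrite ge0_fin_numE// (le_lt_trans IM)// ltry.
have Jf : J \is a fin_num by rewrite ge0_fin_numE// (le_lt_trans JM)// ltry.
have key t : 0 <= t -> ((2 * t)%:E * I <= (t ^+ 2 * M)%:E + J)%E.
  move=> t0; rewrite -ge0_integralZl_EFin ?mulr_ge0//; last 2 first.
  - by move=> y _; rewrite lee_fin mulr_ge0.
  - exact: measurable_kernelM.
  apply: (@le_trans _ _ (\int[leb R d]_(y in D) ((K x y * t ^+ 2)%:E + (K x y * f y ^+ 2)%:E))%E).
    apply: ge0_le_integral => //.
    - by move=> y _; rewrite -EFinM lee_fin !mulr_ge0.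
    - by apply: measurable_funeM; exact: measurable_kernelM.
    - by apply: emeasurable_funD; exact: measurable_kernelM.
    - move=> y _; rewrite -EFinM -EFinD lee_fin -mulrDr mulrCA ler_wpM2l//.
      by have := sqr_ge0 (t - f y); move: (f y) => z; nra.
  rewrite ge0_integralD//; last 4 first.
  - by move=> y _; rewrite lee_fin mulr_ge0 ?sqr_ge0.
  - exact: measurable_kernelM.
  - by move=> y _; rewrite lee_fin mulr_ge0.
  - exact: measurable_kernelM.
  by apply: leeD => //; apply: integral_kernel_le; rewrite ?sqr_ge0//; apply: aeW.
have i0 : 0 <= fine I by exact: fine_ge0.
have t0 : 0 <= fine I / M by rewrite divr_ge0// ltW.
have := key _ t0; rewrite -(fineK If) -(fineK Jf) -!EFinM -EFinD !lee_fin.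
move: (fine I) (fine J) => i j {}.
rewrite (_ : 2 * (i / M) * i = 2 * (i ^+ 2 / M)); last by ring.
rewrite (_ : (i / M) ^+ 2 * M = i ^+ 2 / M); last by field; rewrite gt_eqF.
move=> H; have : i ^+ 2 / M <= j by lra.
by rewrite ler_pdivrMr// mulrC -expr2.
Qed.

(* Schur's test: the kernel is symmetric, so after Tonelli the same bound [M]
   serves for the integration in the other variable. *)
Lemma integral_sqr_potential_le M h : kernel_bound M -> Lp +oo D h ->
  (\int[leb R d]_(x in D) ((cnorm (potential k D h x) ^+ 2)%:E) <=
   ((2 * M) ^+ 2)%:E * \int[leb R d]_(y in D) (cnorm (h y) ^+ 2)%:E)%E.
Proof.
move=> hM Lh; have [M0 HM] := hM; have [mh hy] := (LpP _ _ _).1 Lh.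
have mc := measurable_on_cnorm mh.
have c0 : 0 <= fine (Lpnorm +oo D h) by rewrite fine_ge0// Lpnorm_ge0.
have mc2 : measurable_fun D (fun y => cnorm (h y) ^+ 2) by exact: measurable_funX.
have h0 y : 0 <= cnorm (h y) by exact: cnorm_ge0.
have h20 y : 0 <= cnorm (h y) ^+ 2 by exact: sqr_ge0.
pose J x := (\int[leb R d]_(y in D) (K x y * cnorm (h y) ^+ 2)%:E)%E.
(* Extension by 0 in both variables puts the double integral on the whole product space, where
   Tonelli's theorem is stated. *)
pose G (z : 'rV[R]_d * 'rV[R]_d) : \bar R :=
  (\1_D z.1 * (K z.1 z.2 * ((fun y => cnorm (h y) ^+ 2) \_ D) z.2))%:E.
have r0 y : 0 <= ((fun y => cnorm (h y) ^+ 2) \_ D) y by rewrite patchE; case: ifP.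
have G0 z : (0 <= G z)%E by rewrite lee_fin !mulr_ge0 ?cnorm_ge0.
have mG : measurable_fun setT G.
  have [mr mi] := measurable_Phi k hd.
  apply/measurable_EFinP; apply: measurable_funM.
    by apply: (measurableT_comp (f := \1_D : 'rV[R]_d -> R)) => //; exact: measurable_indic.
  apply: measurable_funM.
    apply: (measurableT_comp (f := fun z => cnorm (Phi k z))).
      exact: measurable_cnorm.
    exact: measurable_rV_sub.
  apply: (measurableT_comp ((measurable_restrictT _ mD).1 mc2)) => //.
have JE x : (J \_ D) x = (\int[leb R d]_y G (x, y))%E.
  rewrite patchE; case: ifPn => xD.
    rewrite /J integral_mkcond; apply: eq_integral => y _.
    by rewrite /G/= !patchE indicE xD mul1r; case: ifPn => //; rewrite mulr0.
  by rewrite integral0_eq// => y _; rewrite /G/= indicE (negbTE xD) mul0r.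
have step x : D x -> ((cnorm (potential k D h x) ^+ 2)%:E <= (4 * M)%:E * J x)%E.
  move=> Dx; have H := sqr_integral_kernel_le hM Dx c0 mc h0 (Lpy_ae_bound Lh).
  have P := cnorm_potential_le x mh.
  rewrite expr2 EFinM.
  apply: (le_trans (lee_pmul _ _ P P)); rewrite ?lee_fin ?cnorm_ge0//.
  rewrite muleACA -EFinM (_ : 2 * 2 = 4)%R; last by ring.
  by rewrite (EFinM 4) -muleA lee_wpmul2l// lee_fin.
have mJ : measurable_fun setT (J \_ D).
  by rewrite (funext JE); exact: measurable_integral_leb.
have J0 x : (0 <= (J \_ D) x)%E by rewrite JE integral_ge0.
apply: (@le_trans _ _ (\int[leb R d]_(x in D) ((4 * M)%:E * J x))%E).
  apply: ge0_le_integral => //.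
  - by move=> x _; rewrite lee_fin sqr_ge0.
  - apply/measurable_EFinP; apply: measurable_funX.
    by apply: measurable_on_cnorm; exact: measurable_potential.
  - by apply: measurable_funeM; apply/(measurable_restrictT _ mD).
rewrite ge0_integralZl_EFin//; last 3 first.
- by move=> x Dx; have := J0 x; rewrite patchE mem_set.
- by apply/(measurable_restrictT _ mD).
- by rewrite mulr_ge0// ltW.
(* One [M] was spent in Cauchy-Schwarz, and the other is reserved for integrating the kernel in [x]
   after the exchange; the 4 is the square of the factor 2 from the two components. *)
rewrite (_ : (2 * M) ^+ 2 = 4 * M * M); last by ring.
rewrite (EFinM (4 * M)) -muleA lee_wpmul2l ?lee_fin ?mulr_ge0 ?(ltW M0)//.
rewrite integral_mkcond (funext JE).
have := fubini_tonelli (m1 := @sfleb R d) (m2 := @sfleb R d) G mG G0.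
rewrite /fubini_F /fubini_G => ->.
rewrite -ge0_integralZl_EFin ?(ltW M0)//; last exact/measurable_EFinP.
rewrite [leRHS]integral_mkcond.
apply: ge0_le_integral => //.
- by move=> y _; exact: integral_ge0.
- exact: (measurable_fun_fubini_tonelli_G (m1 := @sfleb R d) G mG G0).
- by apply/(measurable_restrictT _ mD); apply: measurable_funeM; exact/measurable_EFinP.
move=> y _; rewrite patchE; case: ifPn => yD; last first.
  rewrite integral0_eq// => x _.
  by rewrite /G/= [X in _ * (_ * X)]patchE (negbTE yD) !mulr0.
have Dy : D y by rewrite -in_setE.
rewrite -EFinM mulrC.
apply: le_trans; last first.
  apply: (@integral_kernel_le M y (cst (cnorm (h y) ^+ 2)) _ hM Dy (h20 y)) => //.
    by move=> x; exact: h20.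
  by apply: aeW.
rewrite [leRHS]integral_mkcond le_eqVlt; apply/orP; left; apply/eqP.
apply: eq_integral => x _; rewrite /G/= !patchE indicE yD kernelC.
by case: ifPn; rewrite ?mul1r ?mul0r.
by move=> x _; rewrite lee_fin.
Qed.

Lemma Lpnorm2_potential_le M h : kernel_bound M -> Lp +oo D h ->
  (Lpnorm 2%:E D (potential k D h) <= (2 * M)%:E * Lpnorm 2%:E D h)%E.
Proof.
move=> hM Lh; have [M0 _] := hM.
have M20 : 0 <= 2 * M by rewrite mulr_ge0// ltW.
rewrite !Lpnorm2E -[(2 * M) in leRHS](_ : ((2 * M) ^+ 2) `^ 2^-1 = 2 * M); last first.
  by rewrite -powR_mulrn// -powRrM mulfV// powRr1.
have i0 (f : 'rV[R]_d -> R[i]) : (0 <= \int[leb R d]_(x in D) (cnorm (f x) ^+ 2)%:E)%E.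
  by apply: integral_ge0 => x _; rewrite lee_fin sqr_ge0.
rewrite -poweR_EFin -poweRM ?lee_fin ?sqr_ge0//.
apply: gt0_ler_poweR; rewrite ?invr_ge0//.
- by rewrite in_itv/= leey andbT; exact: (i0 (potential k D h)).
- by rewrite in_itv/= leey andbT mule_ge0 ?lee_fin ?sqr_ge0.
exact: integral_sqr_potential_le.
Qed.

End potential.

(** * The superposition operator *)

(** A countable dense family of complex numbers, over which null sets can be united. *)
Definition ratc (R : realType) (p : rat * rat) : R[i] := ratr p.1 +i* ratr p.2.

Lemma ratc_dense (R : realType) (z : R[i]) (e : R) : 0 < e ->
  exists p, cnorm (z - ratc R p) < e.
Proof.
move=> e0.
have q (t : R) : exists p : rat, `|t - ratr p| < e / 2.
  have [p] : exists p : rat, ratr p \in `](t - e / 2), (t + e / 2)[.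
    by apply: rat_in_itvoo; lra.
  by rewrite in_itv/= => /andP[? ?]; exists p; rewrite ltr_norml; lra.
have [p1 h1] := q (complex.Re z); have [p2 h2] := q (complex.Im z).
exists (p1, p2); apply: (le_lt_trans (cnorm_le_ReIm _)).
by rewrite ReD ImD ReN ImN /= (splitr e) ltrD.
Qed.

Lemma ler_cnorm_dist (R : realType) (x y : R[i]) : `|cnorm x - cnorm y| <= cnorm (x - y).
Proof.
have := ler_cnormD (x - y) y; have := ler_cnormD (y - x) x.
by rewrite !subrK (cnormB y x) ler_norml => *; lra.
Qed.

(** The approximant must not be larger than [z], to stay in the unit disk and not increase the
    powers of the modulus, and must not vanish unless [z] does, because continuity in the modulus is
    available only on []0, 1]]. Approximating [(1 - t) * z] up to [t * |z|] with [t <= 1/4] achieves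
    both. *)
Lemma ratc_dense_disk (R : realType) (z : R[i]) (e : R) : 0 < e -> cnorm z <= 1 ->
  exists p, [/\ cnorm (ratc R p) <= cnorm z, cnorm (z - ratc R p) < e &
    z != 0 -> 0 < cnorm (ratc R p)].
Proof.
move=> e0 z1; have [->|z0] := eqVneq z 0.
  have r0 : ratc R (0, 0) = 0 by rewrite /ratc/= rmorph0.
  by exists (0, 0); rewrite r0 subr0 cnorm0; split; rewrite ?eqxx.
have cz : 0 < cnorm z.
  by rewrite lt_neqAle cnorm_ge0 andbT eq_sym; apply: contra z0 => /eqP/cnorm_eq0/eqP.
pose t := Num.min 4^-1 (e / 4).
have t0 : 0 < t by rewrite lt_min; apply/andP; split; lra.
have t4 : t <= 4^-1 by rewrite ge_min lexx.
have te : t <= e / 4 by rewrite ge_min lexx orbT.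
have tz : 0 < t * cnorm z by rewrite mulr_gt0.
have [p Hp] := ratc_dense ((1 - t)%:C * z) tz.
have E : cnorm ((1 - t)%:C * z) = (1 - t) * cnorm z.
  by rewrite cnormM cnorm_real ger0_norm//; lra.
have := ler_cnorm_dist ((1 - t)%:C * z) (ratc R p); rewrite E => H1.
have H2 : cnorm (z - ratc R p) <= t * cnorm z + cnorm ((1 - t)%:C * z - ratc R p).
  rewrite [X in cnorm X <= _](_ : _ = t%:C * z + ((1 - t)%:C * z - ratc R p)); last first.
    by rewrite rmorphB rmorph1; ring.
  by apply: (le_trans (ler_cnormD _ _)); rewrite cnormM cnorm_real ger0_norm// ltW.
move: H1; rewrite ler_norml => /andP[H1 H3].
have tz1 : t * cnorm z <= t by rewrite ler_piMr// ltW.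
exists p; split => [||_]; [nra| |nra].
by apply: (le_lt_trans H2); lra.
Qed.

(** The map [z |-> h |z| * z] can be approximated along rational points: away from 0 by continuity
    of [h], and at 0 because the product vanishes whatever [h 0] is. *)
Lemma superposition_lipschitz (R : realType) (h : R -> R) (b C alpha : R) :
  0 < C -> 0 <= alpha ->
  {within `]0, 1], continuous h} ->
  (forall p1 p2, let z1 := ratc R p1 in let z2 := ratc R p2 in
     cnorm z1 <= 1 -> cnorm z2 <= 1 ->
     cnorm ((h (cnorm z1))%:C * z1 - (h (cnorm z2))%:C * z2 - b%:C * (z1 - z2)) <=
     C * (cnorm z1 `^ alpha + cnorm z2 `^ alpha) * cnorm (z1 - z2)) ->
  forall z1 z2, cnorm z1 <= 1 -> cnorm z2 <= 1 ->
     cnorm ((h (cnorm z1))%:C * z1 - (h (cnorm z2))%:C * z2 - b%:C * (z1 - z2)) <=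
     C * (cnorm z1 `^ alpha + cnorm z2 `^ alpha) * cnorm (z1 - z2).
Proof.
move=> C0 a0 hc H.
pose phi (z : R[i]) := (h (cnorm z))%:C * z.
have approx z e : cnorm z <= 1 -> 0 < e -> exists p,
    [/\ cnorm (ratc R p) <= cnorm z, cnorm (z - ratc R p) < e &
        cnorm (phi z - phi (ratc R p)) < e].
  move=> z1 e0; have [z0|z0] := eqVneq z 0.
    have [p [p1 p2 _]] := ratc_dense_disk e0 z1.
    exists p; split => //; move: p1; rewrite z0 cnorm0 => p1.
    rewrite (cnorm_eq0 (z := ratc R p)) /phi ?mulr0 ?subr0 ?cnorm0//.
    by apply/eqP; rewrite eq_le p1 cnorm_ge0.
  have cz : 0 < cnorm z.
    by rewrite lt_neqAle cnorm_ge0 andbT eq_sym; apply: contra z0 => /eqP/cnorm_eq0/eqP.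
  have zin : `]0, 1]%classic (cnorm z) by rewrite /= in_itv/= cz z1.
  have e20 : 0 < e / 2 by rewrite divr_gt0.
  have /subspace_continuousP /(_ _ zin) /cvgrPdist_lt /(_ _ e20) := hc.
  rewrite near_withinE => -[/= r r0 Hr].
  (* The three terms make [h] vary by less than [e / 2], bring the approximant within [e] of [z],
     and keep [|h |z||] times the distance below [e / 2]. *)
  pose s := Num.min r (Num.min e (e / 2 / (`|h (cnorm z)| + 1))).
  have hz : 0 < `|h (cnorm z)| + 1 by rewrite ltr_wpDl.
  have s0 : 0 < s by rewrite !lt_min r0 e0 divr_gt0.
  have [p [p1 p2 p3]] := ratc_dense_disk s0 z1.
  have [sr se sh] : [/\ s <= r, s <= e & s <= e / 2 / (`|h (cnorm z)| + 1)].
    by split; rewrite !ge_min lexx ?orbT.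
  exists p; split => //; first exact: lt_le_trans p2 se.
  have Hw : `|h (cnorm z) - h (cnorm (ratc R p))| < e / 2.
    have {}Hr t : `|cnorm z - t| < r -> 0 < t <= 1 -> `|h (cnorm z) - h t| < e / 2.
      by move=> t1 t2; apply: Hr => //=; rewrite in_itv.
    apply: Hr; last by rewrite p3// (le_trans p1).
    by apply: (le_lt_trans (ler_cnorm_dist _ _)); exact: lt_le_trans p2 sr.
  rewrite /phi [X in cnorm X](_ : _ = (h (cnorm z))%:C * (z - ratc R p) +
    (h (cnorm z) - h (cnorm (ratc R p)))%:C * ratc R p); last by rewrite rmorphB; ring.
  apply: (le_lt_trans (ler_cnormD _ _)); rewrite !cnormM !cnorm_real (splitr e).
  apply: ler_ltD.
    have : cnorm (z - ratc R p) <= e / 2 / (`|h (cnorm z)| + 1).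
      by apply: (le_trans (ltW p2)).
    rewrite ler_pdivlMr// => ?.
    have := cnorm_ge0 (z - ratc R p); nra.
  apply: le_lt_trans Hw; rewrite ler_piMr// (le_trans p1)//.
move=> z1 z2 hz1 hz2.
set P := C * (_ + _).
have A0 : 0 <= C * (cnorm z1 `^ alpha + cnorm z2 `^ alpha).
  by rewrite mulr_ge0 ?(ltW C0)// addr_ge0 ?powR_ge0.
rewrite -/P in A0; set A := P * _.
(* The error has three sources: [2 * P] from replacing [|w1 - w2|] by [|z1 - z2| + 2 * e], 2 from
   the two values of [phi], and [2 * |b|] from the linear term. *)
have key e : 0 < e -> cnorm (phi z1 - phi z2 - b%:C * (z1 - z2)) <=
    A + (2 * P + 2 + 2 * `|b|) * e.
  move=> e0; have [p1 [a1 b1 c1]] := approx _ _ hz1 e0.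
  have [p2 [a2 b2 c2]] := approx _ _ hz2 e0.
  have := H p1 p2 (le_trans a1 hz1) (le_trans a2 hz2); cbv zeta.
  set w1 := ratc R p1 in a1 b1 c1 *; set w2 := ratc R p2 in a2 b2 c2 *.
  rewrite -/(phi w1) -/(phi w2) => Hw.
  rewrite [X in cnorm X](_ : _ = (phi w1 - phi w2 - b%:C * (w1 - w2)) +
    ((phi z1 - phi w1) - (phi z2 - phi w2) - b%:C * ((z1 - w1) - (z2 - w2)))); last by ring.
  apply: (le_trans (ler_cnormD _ _)).
  have d12 : cnorm (w1 - w2) <= cnorm (z1 - z2) + 2 * e.
    rewrite [X in cnorm X <= _](_ : _ = (z1 - z2) - ((z1 - w1) - (z2 - w2))); last by ring.
    apply: (le_trans (ler_cnormB _ _)); rewrite lerD2l.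
    by apply: (le_trans (ler_cnormB _ _)); lra.
  have T1 : cnorm (phi w1 - phi w2 - b%:C * (w1 - w2)) <= P * (cnorm (z1 - z2) + 2 * e).
    apply: (le_trans Hw); apply: ler_pM => //; rewrite ?cnorm_ge0//.
      by rewrite mulr_ge0 ?(ltW C0)// addr_ge0 ?powR_ge0.
    rewrite ler_pM2l//; apply: lerD; apply: ge0_ler_powR; rewrite ?nnegrE ?cnorm_ge0//.
  have T2 : cnorm (phi z1 - phi w1 - (phi z2 - phi w2) - b%:C * (z1 - w1 - (z2 - w2)))
      <= 2 * e + `|b| * (2 * e).
    apply: (le_trans (ler_cnormB _ _)); apply: lerD.
      by apply: (le_trans (ler_cnormB _ _)); lra.
    rewrite cnormM cnorm_real ler_wpM2l//.
    by apply: (le_trans (ler_cnormB _ _)); lra.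
  apply: (le_trans (lerD T1 T2)); rewrite /A; nra.
rewrite -/(phi z1) -/(phi z2).
apply/ler_addgt0Pr => e e0.
have B0 : 0 < 2 * P + 2 + 2 * `|b| by have := normr_ge0 b; lra.
have := key (e / (2 * P + 2 + 2 * `|b|)) (divr_gt0 e0 B0).
by rewrite (mulrC (2 * P + _ + _)) divfK// gt_eqF.
Qed.

Definition superposition (R : realType) d (q : 'rV[R]_d -> R -> R)
    (w : 'rV[R]_d -> R[i]) : 'rV[R]_d -> R[i] :=
  fun y => (q y (cnorm (w y)))%:C * w y.

Definition remainder (R : realType) d (q : 'rV[R]_d -> R -> R) (q0 : 'rV[R]_d -> R)
    (w : 'rV[R]_d -> R[i]) : 'rV[R]_d -> R[i] :=
  fun y => superposition q w y - (q0 y)%:C * w y.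

Section remainder.
Context {R : realType} {d : nat} (D : set 'rV[R]_d).
Context (q : 'rV[R]_d -> R -> R) (q0 : 'rV[R]_d -> R) (alpha : R).
Hypotheses (hq : contrast D q q0 alpha) (hqc : continuous_representative q).
Hypothesis mD : measurable D.
Implicit Types w : 'rV[R]_d -> R[i].

Lemma measurable_contrast :
  measurable_fun setT (fun p : 'rV[R]_d * measurableTypeR R => q p.1 p.2).
Proof. by have /sub_Lfun_mfun := contrast_Linfty hq; rewrite inE. Qed.

Lemma measurable_linear_contrast : measurable_fun setT q0.
Proof. by have /sub_Lfun_mfun := linear_contrast_Linfty hq; rewrite inE. Qed.

Lemma measurable_on_superposition w : measurable_on D w -> measurable_on D (superposition q w).
Proof.
move=> mw; apply: measurable_onM => //; apply: measurable_on_real.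
(* As [w] is measurable only on [D], its modulus is cut off before it is inserted into the jointly
   measurable [q]. *)
pose r : 'rV[R]_d -> measurableTypeR R := (fun x => cnorm (w x)) \_ D.
apply: (@eq_measurable_fun _ _ _ _ _ (fun x => q x (r x))).
  by move=> x xD; rewrite /r /= patchE xD.
apply: measurable_funTS.
apply: (measurableT_comp (f := fun p : 'rV[R]_d * measurableTypeR R => q p.1 p.2)
  (g := fun x => (x, r x))); first exact: measurable_contrast.
by apply: measurable_fun_pair => //; exact: measurable_on_restrict.
Qed.

Lemma measurable_on_q0M w : measurable_on D w -> measurable_on D (fun y => (q0 y)%:C * w y).
Proof.
move=> mw; apply: measurable_onM => //; apply: measurable_on_real.
by apply: measurable_funTS; exact: measurable_linear_contrast.
Qed.

Lemma linear_contrast_bound : exists2 b : R, 0 <= b & {ae leb R d, forall x, `|q0 x| <= b}.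
Proof.
have := linear_contrast_Linfty hq.
move=> /sub_Lfun_finLfun; rewrite inE /finite_norm unlock leb_setT_gt0 => H.
pose s := ess_sup (leb R d) (abse \o (EFin \o q0)).
have {}H : (s < +oo)%E := H.
have s0 : (0 <= s)%E by apply: ess_sup_gee; rewrite ?leb_setT_gt0//; apply: aeW => x /=; rewrite lee_fin.
have sf : s \is a fin_num by rewrite ge0_fin_numE.
exists (fine s); first exact: fine_ge0.
apply: filterS (ess_sup_ge (leb R d) (abse \o (EFin \o q0))) => x /=.
by rewrite -/s -{1}(fineK sf) lee_fin.
Qed.

Lemma Lpy_q0M w : Lp +oo D w -> Lp +oo D (fun y => (q0 y)%:C * w y).
Proof.
move=> /LpP[mw wy]; have [b b0 hb] := linear_contrast_bound.
apply/LpP; split; first exact: measurable_on_q0M.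
have H : (Lpnorm +oo D (fun y => (q0 y)%:C * w y)%R <= b%:E * Lpnorm +oo D w)%E.
  apply: le_Lpnorm_scale => //; [by right|exact: measurable_on_q0M|].
  apply: filterS hb => x bx _.
  by rewrite cnormM cnorm_real ler_wpM2r// cnorm_ge0.
by apply: (le_lt_trans H); rewrite lte_mul_pinfty ?lee_fin.
Qed.

(** Here the quantifiers are exchanged: a single null set now serves all pairs [z1], [z2], so that
    values of functions may be substituted. Rational pairs are enumerated by [unpickle], and
    continuity supplies the others. *)
Lemma ae_contrast_lipschitz : exists2 C : R, 0 < C &
  {ae leb R d, forall x z1 z2, cnorm z1 <= 1 -> cnorm z2 <= 1 ->
    cnorm ((q x (cnorm z1))%:C * z1 - (q x (cnorm z2))%:C * z2 - (q0 x)%:C * (z1 - z2)) <=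
    C * (cnorm z1 `^ alpha + cnorm z2 `^ alpha) * cnorm (z1 - z2)}.
Proof.
have [C C0 HC] := contrast_lipschitz hq; exists C => //.
pose P (p : (rat * rat) * (rat * rat)) x :=
  let z1 := ratc R p.1 in let z2 := ratc R p.2 in
  cnorm z1 <= 1 -> cnorm z2 <= 1 ->
  cnorm ((q x (cnorm z1))%:C * z1 - (q x (cnorm z2))%:C * z2 - (q0 x)%:C * (z1 - z2)) <=
    C * (cnorm z1 `^ alpha + cnorm z2 `^ alpha) * cnorm (z1 - z2).
have Pae : {ae leb R d, forall x, forall n : nat,
    if unpickle n is Some p then P p x else True}.
  apply: ae_foralln => n; case: (unpickle n) => [p|]; last exact: aeW.
  rewrite /P; case: (leP (cnorm (ratc R p.1)) 1) => h1; last exact: aeW.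
  case: (leP (cnorm (ratc R p.2)) 1) => h2; last exact: aeW.
  have := HC _ _ h1 h2; rewrite Lpnormy_leP; last first.
    by rewrite mulr_ge0 ?cnorm_ge0// mulr_ge0 ?(ltW C0)// addr_ge0 ?powR_ge0.
  by apply: filterS => x /(_ I).
apply: filterS2 Pae hqc => x Px cx z1 z2.
apply: superposition_lipschitz => //; first exact: (ltW (contrast_alpha hq)).
by move=> p1 p2; have := Px (pickle (p1, p2)); rewrite pickleK.
Qed.

Lemma remainder0 : remainder q q0 (fun=> 0) = fun=> 0.
Proof. by apply/funext => y; rewrite /remainder /superposition !mulr0 subr0. Qed.

Lemma measurable_on_remainder w : measurable_on D w -> measurable_on D (remainder q q0 w).
Proof.
move=> mw; apply: measurable_onB; first exact: measurable_on_superposition.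
exact: measurable_on_q0M.
Qed.

(** The sup norms of [w1] and [w2] bound the small factor pointwise, so the same constant multiplies
    the difference in L^oo and in L^2. *)
Lemma remainder_lipschitz : exists2 C : R, 0 < C & forall p w1 w2 (r1 r2 : R),
  Lp_exponent p -> Lp +oo D w1 -> Lp +oo D w2 -> r1 <= 1 -> r2 <= 1 ->
  (Lpnorm +oo D w1 <= r1%:E)%E -> (Lpnorm +oo D w2 <= r2%:E)%E ->
  (Lpnorm p D (fun y => remainder q q0 w1 y - remainder q q0 w2 y)%R <=
   (C * (r1 `^ alpha + r2 `^ alpha))%:E * Lpnorm p D (fun y => w1 y - w2 y)%R)%E.
Proof.
have [C C0 HC] := ae_contrast_lipschitz; exists C => //.
move=> p w1 w2 r1 r2 hp L1 L2 r11 r21 N1 N2.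
have r10 : 0 <= r1 by have := le_trans (Lpnorm_ge0 _ _ _) N1; rewrite lee_fin.
have r20 : 0 <= r2 by have := le_trans (Lpnorm_ge0 _ _ _) N2; rewrite lee_fin.
have [m1 _] := (LpP _ _ _).1 L1; have [m2 _] := (LpP _ _ _).1 L2.
apply: le_Lpnorm_scale => //.
- by rewrite mulr_ge0 ?(ltW C0)// addr_ge0 ?powR_ge0.
- by apply: measurable_onB; exact: measurable_on_remainder.
- exact: measurable_onB.
have /(Lpnormy_leP _ _ r10) B1 := N1; have /(Lpnormy_leP _ _ r20) B2 := N2.
apply: filterS3 HC B1 B2 => x Hx b1 b2 Dx.
have {}b1 := b1 Dx; have {}b2 := b2 Dx.
rewrite /remainder /superposition [X in cnorm X <= _](_ : _ =
  (q x (cnorm (w1 x)))%:C * w1 x - (q x (cnorm (w2 x)))%:C * w2 x - (q0 x)%:C * (w1 x - w2 x)); last by ring.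
apply: (le_trans (Hx _ _ (le_trans b1 r11) (le_trans b2 r21))).
rewrite ler_wpM2r ?cnorm_ge0// ler_pM2l// lerD//;
  by apply: ge0_ler_powR; rewrite ?nnegrE ?cnorm_ge0 ?(ltW (contrast_alpha hq)).
Qed.

Lemma Lpy_remainder w : Lp +oo D w -> (Lpnorm +oo D w <= 1)%E -> Lp +oo D (remainder q q0 w).
Proof.
move=> Lw w1; have [mw wy] := (LpP _ _ _).1 Lw.
apply/LpP; split; first exact: measurable_on_remainder.
have [C C0 HC] := remainder_lipschitz.
have m0 : measurable_on D (fun=> 0 : R[i]) by exact: measurable_on_cst.
have N0 : Lpnorm +oo D (fun=> 0 : R[i]) = 0%E.
  by apply: Lpnorm_ae0 => //; [right|apply: aeW].
have L0 : Lp +oo D (fun=> 0 : R[i]) by apply/LpP; rewrite N0.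
(* Comparison with 0, whose remainder vanishes, turns the Lipschitz bound into a bound on the
   remainder of [w]. *)
have := HC +oo%E w (fun=> 0) 1 1 (or_intror erefl) Lw L0 (lexx _) (lexx _) w1.
rewrite N0 remainder0 lee_fin ler01 => /(_ isT).
under eq_fun do rewrite subr0.
under [X in (_ <= _ * Lpnorm _ _ X)%E -> _]eq_fun do rewrite subr0.
move=> /le_lt_trans; apply.
by rewrite lte_mul_pinfty ?lee_fin// mulr_ge0 ?(ltW C0)// addr_ge0 ?powR_ge0.
Qed.

End remainder.

(** * The scattering problem *)

Section bounded_linear_on.
Context {R : realType} {d : nat} (D : set 'rV[R]_d) (p : \bar R).
Hypotheses (mD : measurable D) (hp : Lp_exponent p).
Implicit Types (T S : ('rV[R]_d -> R[i]) -> 'rV[R]_d -> R[i]) (f g h : 'rV[R]_d -> R[i]).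

Lemma bounded_linear_on_ge0 T : bounded_linear_on p D T -> exists2 C : R, 0 <= C &
  forall h, Lp p D h -> (Lpnorm p D (T h) <= C%:E * Lpnorm p D h)%E.
Proof.
move=> [_ _ [C HC]]; exists (Num.max C 0); first by rewrite le_max lexx orbT.
move=> h Lh; apply: (le_trans (HC h Lh)).
by apply: lee_wpmul2r; rewrite ?Lpnorm_ge0// lee_fin le_max lexx.
Qed.

Lemma bounded_linear_onB T g h : bounded_linear_on p D T -> Lp p D g -> Lp p D h ->
  T (fun x => g x - h x) = (fun x => T g x - T h x) %[ae leb R d in D].
Proof.
move=> [_ TL _] Lg Lh; have := TL (-1) h g Lh Lg.
rewrite (_ : (fun x => -1 * h x + g x) = (fun x => g x - h x)); last first.
  by apply/funext => x; rewrite mulN1r addrC.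
by apply: filterS => x /[apply] ->; rewrite mulN1r addrC.
Qed.

(** An operator acts on functions, and could a priori see the representative. Boundedness rules this
    out: the image of a null function has norm 0. *)
Lemma bounded_linear_on_ae T g h : bounded_linear_on p D T -> Lp p D g -> Lp p D h ->
  g = h %[ae leb R d in D] -> T g = T h %[ae leb R d in D].
Proof.
move=> BT Lg Lh gh; have [C C0 HC] := bounded_linear_on_ge0 BT.
have Lgh : Lp p D (fun x => g x - h x) by exact: LpB.
have [mgh _] := (LpP _ _ _).1 Lgh.
have N0 : Lpnorm p D (fun x => g x - h x) = 0%E.
  by apply: Lpnorm_ae0 => //; apply: filterS gh => x /[apply] ->; rewrite subrr.
have T0 : Lpnorm p D (T (fun x => g x - h x)) = 0%E.
  by apply/eqP; rewrite eq_le Lpnorm_ge0 andbT (le_trans (HC _ Lgh))// N0 mule0.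
have [Tcl _ _] := BT.
have := Lpnorm_eq0 hp mD (proj1 ((LpP _ _ _).1 (Tcl _ Lgh))) T0.
apply: filterS2 (bounded_linear_onB BT Lg Lh) => x H1 H0 Dx.
by apply/eqP; rewrite -subr_eq0 -H1// H0.
Qed.

Lemma LpD g h : Lp p D g -> Lp p D h -> Lp p D (fun x => g x + h x).
Proof.
move=> /LpP[mg gp] /LpP[mh hp']; apply/LpP; split; first exact: measurable_onD.
by apply: (le_lt_trans (LpnormD hp mD mg mh)); exact: lte_add_pinfty.
Qed.

Lemma Lp_ae g h : measurable_on D g -> Lp p D h -> g = h %[ae leb R d in D] -> Lp p D g.
Proof.
by move=> mg /LpP[mh hh] gh; apply/LpP; split => //; rewrite (eq_Lpnorm hp mD mg mh gh).
Qed.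

Lemma Lpnorm_fin_num g : Lp p D g -> Lpnorm p D g \is a fin_num.
Proof. by move=> /LpP[_ ?]; rewrite ge0_fin_numE// Lpnorm_ge0. Qed.

End bounded_linear_on.

Section scattering_operators.
Context {R : realType} {d : nat} (k : R) (D : set 'rV[R]_d).
Context (q : 'rV[R]_d -> R -> R) (q0 : 'rV[R]_d -> R) (alpha : R).
Hypotheses (hd : d = 2%N \/ d = 3%N) (hk : 0 < k) (mD : measurable D) (bD : bounded_set D).
Hypotheses (hq : contrast D q q0 alpha) (hqc : continuous_representative q).
Implicit Types f g h v w : 'rV[R]_d -> R[i].

Let Doo : (leb R d D < +oo)%E. Proof. exact: leb_bounded_lty. Qed.

Let y_exp : Lp_exponent (+oo%E : \bar R). Proof. by right. Qed.
Let two_exp : Lp_exponent (2%:E : \bar R). Proof. by left. Qed.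

Definition volume_potential h : 'rV[R]_d -> R[i] := fun x => (k ^+ 2)%:C * potential k D h x.

Lemma volume_potential_bound : exists2 M : R, 0 < M & forall h, Lp +oo D h ->
  Lp +oo D (volume_potential h) /\ forall p, Lp_exponent p ->
  (Lpnorm p D (volume_potential h) <= M%:E * Lpnorm p D h)%E.
Proof.
have [M M0 HM] := integral_Phi_le hd hk mD bD.
have kM : kernel_bound k D M by [].
exists (k ^+ 2 * (2 * M)); first by rewrite mulr_gt0 ?exprn_gt0// mulr_gt0.
move=> h Lh; have [mh hy] := (LpP _ _ _).1 Lh.
have mp := measurable_potential k hd mD mh.
have mk : measurable_on D (volume_potential h).
  by apply: measurable_onM => //; exact: measurable_on_cst.
have bnd p : Lp_exponent p ->
    (Lpnorm p D (volume_potential h) <= (k ^+ 2 * (2 * M))%:E * Lpnorm p D h)%E.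
  move=> hp.
  apply: (@le_trans _ _ ((k ^+ 2)%:E * Lpnorm p D (potential k D h))%E).
    apply: le_Lpnorm_scale => //; first exact: sqr_ge0.
    by apply: aeW => x _; rewrite cnormM cnorm_real ger0_norm ?sqr_ge0.
  rewrite (EFinM (k ^+ 2)) -muleA lee_wpmul2l ?lee_fin ?sqr_ge0//.
  case: hp => ->; first exact: Lpnorm2_potential_le.
  exact: Lpnormy_potential_le.
split => //; apply/LpP; split => //; apply: (le_lt_trans (bnd _ y_exp)).
by rewrite lte_mul_pinfty// lee_fin mulr_ge0 ?sqr_ge0// mulr_ge0// ltW.
Qed.

Lemma volume_potentialB g h x : D x -> Lp +oo D g -> Lp +oo D h ->
  volume_potential (fun y => g y - h y) x = volume_potential g x - volume_potential h x.
Proof.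
move=> Dx Lg Lh; have [M M0 HM] := integral_Phi_le hd hk mD bD.
have kM : kernel_bound k D M by [].
by rewrite /volume_potential (potentialB hd mD kM)// mulrBr.
Qed.

Lemma linear_partE f : linear_part k D q0 f = volume_potential (fun y => (q0 y)%:C * f y).
Proof. by []. Qed.

Lemma Lpy_linear_part f : Lp +oo D f -> Lp +oo D (linear_part k D q0 f).
Proof.
move=> Lf; have [M M0 HM] := volume_potential_bound.
by apply: (HM _ _).1; exact: (Lpy_q0M hq mD).
Qed.

Lemma linear_partB x f g : D x -> Lp +oo D f -> Lp +oo D g ->
  linear_part k D q0 (fun y => f y - g y) x = linear_part k D q0 f x - linear_part k D q0 g x.
Proof.
move=> Dx Lf Lg; rewrite !linear_partE -volume_potentialB//; try exact: (Lpy_q0M hq mD).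
by congr volume_potential; apply/funext => y; rewrite mulrBr.
Qed.

Context (Soo S2 : ('rV[R]_d -> R[i]) -> 'rV[R]_d -> R[i]).
Local Notation T := (linear_op k D q0).
Hypotheses (T2 : bounded_linear_on 2%:E D T) (Too : bounded_linear_on +oo D T).
Hypotheses (bS2 : bounded_linear_on 2%:E D S2) (bSoo : bounded_linear_on +oo D Soo).
Hypotheses (S2T : forall h, Lp 2%:E D h -> S2 (T h) = h %[ae leb R d in D])
  (TS2 : forall h, Lp 2%:E D h -> T (S2 h) = h %[ae leb R d in D])
  (SooT : forall h, Lp +oo D h -> Soo (T h) = h %[ae leb R d in D])
  (TSoo : forall h, Lp +oo D h -> T (Soo h) = h %[ae leb R d in D]).

Let L2 h : Lp +oo D h -> Lp 2%:E D h. Proof. exact: Lpy_sub_Lp2. Qed.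
Let Lpm p h : Lp p D h -> measurable_on D h. Proof. by case/LpP. Qed.

Lemma Soo_closed h : Lp +oo D h -> Lp +oo D (Soo h).
Proof. by case: bSoo => + _ _; exact. Qed.

(* [V0] is built from the inverse on L^2(D), the fixed-point map from the one on
   L^oo(D). *)
Lemma SooE h : Lp +oo D h -> Soo h = S2 h %[ae leb R d in D].
Proof.
move=> Lh; have LS := L2 (Soo_closed Lh).
have LT : Lp 2%:E D (T (Soo h)) by case: T2 => + _ _; exact.
have := bounded_linear_on_ae mD two_exp bS2 LT (L2 Lh) (TSoo Lh).
by apply: filterS2 (S2T LS) => x H1 H2 Dx; rewrite -H1// H2.
Qed.

(** In the L^2 norm the estimate is borrowed from [S2], which agrees with [Soo] on bounded
    functions. *)
Lemma Soo_bound : exists2 C : R, 0 <= C & forall p h, Lp_exponent p -> Lp +oo D h ->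
  (Lpnorm p D (Soo h) <= C%:E * Lpnorm p D h)%E.
Proof.
have [C1 C10 H1] := bounded_linear_on_ge0 bSoo.
have [C2 C20 H2] := bounded_linear_on_ge0 bS2.
exists (Num.max C1 C2); first by rewrite le_max C10.
move=> p h [] -> Lh.
  have LS : Lp 2%:E D (S2 h) by case: bS2 => + _ _; apply; exact: L2.
  rewrite (eq_Lpnorm two_exp mD (Lpm (Soo_closed Lh)) (Lpm LS) (SooE Lh)).
  apply: (le_trans (H2 _ (L2 Lh))).
  by apply: lee_wpmul2r; rewrite ?Lpnorm_ge0// lee_fin le_max lexx orbT.
apply: (le_trans (H1 _ Lh)).
by apply: lee_wpmul2r; rewrite ?Lpnorm_ge0// lee_fin le_max lexx.
Qed.

(** The choice in [V0] is made among solutions in L^2; [S2] provides one, and applying [S2] to the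
    equation identifies the chosen one with the image under [Soo], which is bounded. *)
Lemma V0P f : Lp +oo D f -> Lp +oo D (V0 k D q0 f) /\
  V0 k D q0 f = Soo (linear_part k D q0 f) %[ae leb R d in D].
Proof.
move=> Lf; have Ll := Lpy_linear_part Lf.
have [L20 TV] : Lp 2%:E D (V0 k D q0 f) /\
    T (V0 k D q0 f) = linear_part k D q0 f %[ae leb R d in D].
  rewrite /V0; apply: (xgetPex (cst 0) (P := [set w | Lp 2%:E D w /\
    T w = linear_part k D q0 f %[ae leb R d in D]])).
  exists (S2 (linear_part k D q0 f)); split; last exact: TS2 (L2 Ll).
  by case: bS2 => + _ _; apply; exact: L2.
have LT : Lp 2%:E D (T (V0 k D q0 f)) by case: T2 => + _ _; exact.
have E : V0 k D q0 f = Soo (linear_part k D q0 f) %[ae leb R d in D].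
  have := bounded_linear_on_ae mD two_exp bS2 LT (L2 Ll) TV.
  apply: filterS3 (S2T L20) (SooE Ll) => x H1 H2 H3 Dx.
  by rewrite -H1// H3// H2.
split => //; exact: (Lp_ae mD y_exp (Lpm L20) (Soo_closed Ll) E).
Qed.

Definition fixed_point_map w : 'rV[R]_d -> R[i] := Soo (volume_potential (remainder q q0 w)).

(** Splitting [q(., |w|) w] into [q0 w] and the remainder and moving the part with [q0 v] to the
    left turns the equation into [T v = s], with [s] the sum of [linear_part] of [f] and the
    potential of the remainder. Then [Soo] leads to the fixed-point form, and [T] leads back. *)
Lemma integral_equationP f v : Lp +oo D f -> Lp +oo D v ->
  (Lpnorm +oo D (fun x => v x + f x)%R <= 1)%E ->
  integral_equation k D q f v <->
  v = (fun x => V0 k D q0 f x + fixed_point_map (fun y => v y + f y) x) %[ae leb R d in D].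
Proof.
move=> Lf Lv w1; set w := fun x => v x + f x.
have Lw : Lp +oo D w by exact: LpD.
have Lr : Lp +oo D (remainder q q0 w) by exact: (Lpy_remainder hq hqc mD).
have Lqw := Lpy_q0M hq mD Lw.
have Ls : Lp +oo D (superposition q w).
  have -> : superposition q w = (fun y => remainder q q0 w y + (q0 y)%:C * w y).
    by apply/funext => y; rewrite /remainder subrK.
  exact: LpD.
have [M M0 HM] := volume_potential_bound.
have Lb := (HM _ Lr).1; have Ll := Lpy_linear_part Lf.
set B := volume_potential (remainder q q0 w) in Lb *.
pose s x := linear_part k D q0 f x + B x.
have Lls : Lp +oo D s by exact: LpD.
have [LV0 V0E] := V0P Lf.
have rhsE x : D x -> volume_potential (superposition q w) x - linear_part k D q0 v x = s x.
  move=> Dx; have := volume_potentialB Dx Ls Lqw; rewrite -/(remainder q q0 w) -/B => BE.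
  have := linear_partB Dx Lw Lf; rewrite (_ : (fun y => w y - f y) = v); last first.
    by apply/funext => y; rewrite /w addrK.
  by move=> ->; rewrite /s BE linear_partE; ring.
have eqT : integral_equation k D q f v <-> T v = s %[ae leb R d in D].
  split; apply: filterS => x H Dx; first by rewrite /linear_op H// -rhsE.
  have := H Dx; rewrite /linear_op -rhsE// => /(congr1 (fun z => z + linear_part k D q0 v x)).
  by rewrite !subrK.
have SE : Soo s = (fun x => V0 k D q0 f x + Soo B x) %[ae leb R d in D].
  have := bounded_linear_onB bSoo Lls Lb.
  rewrite (_ : (fun x => s x - B x) = linear_part k D q0 f); last first.
    by apply/funext => x; rewrite /s addrK.
  apply: filterS2 V0E => x H1 H2 Dx.
  by rewrite H1// H2// subrK.
have LTv : Lp +oo D (T v) by case: Too => + _ _; exact.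
rewrite eqT; split => H.
  have := bounded_linear_on_ae mD y_exp bSoo LTv Lls H.
  apply: filterS3 (SooT Lv) SE => x H1 H2 H3 Dx.
  by rewrite -H1// H3// H2.
have vS : v = Soo s %[ae leb R d in D].
  by apply: filterS2 H SE => x H1 H2 Dx; rewrite H1// H2.
have := bounded_linear_on_ae mD y_exp Too Lv (Soo_closed Lls) vS.
by apply: filterS2 (TSoo Lls) => x H1 H2 Dx; rewrite H2// H1.
Qed.

Lemma Lpy_fixed_point_map w : Lp +oo D w -> (Lpnorm +oo D w <= 1)%E ->
  Lp +oo D (fixed_point_map w).
Proof.
move=> Lw w1; have [M M0 HM] := volume_potential_bound.
by apply: Soo_closed; apply: (HM _ _).1; exact: (Lpy_remainder hq hqc mD).
Qed.

Lemma fixed_point_map_lipschitz : exists2 C : R, 0 < C & forall p w1 w2 (r1 r2 : R),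
  Lp_exponent p -> Lp +oo D w1 -> Lp +oo D w2 -> r1 <= 1 -> r2 <= 1 ->
  (Lpnorm +oo D w1 <= r1%:E)%E -> (Lpnorm +oo D w2 <= r2%:E)%E ->
  (Lpnorm p D (fun y => fixed_point_map w1 y - fixed_point_map w2 y)%R <=
   (C * (r1 `^ alpha + r2 `^ alpha))%:E * Lpnorm p D (fun y => w1 y - w2 y)%R)%E.
Proof.
have [M M0 HM] := volume_potential_bound.
have [C1 C10 H1] := Soo_bound.
have [C C0 HC] := remainder_lipschitz hq hqc mD.
(* The factors come from the inverse, the potential and the remainder; adding 1 makes the first of
   them positive. *)
exists ((C1 + 1) * M * C); first by rewrite !mulr_gt0// ltr_wpDl.
move=> p w1 w2 r1 r2 hp L1 Lw2 r11 r21 N1 N2.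
have R1 : Lp +oo D (remainder q q0 w1).
  by apply: (Lpy_remainder hq hqc mD L1); rewrite (le_trans N1)// lee_fin.
have R2 : Lp +oo D (remainder q q0 w2).
  by apply: (Lpy_remainder hq hqc mD Lw2); rewrite (le_trans N2)// lee_fin.
have B1 := (HM _ R1).1; have B2 := (HM _ R2).1.
have RB : Lp +oo D (fun x => remainder q q0 w1 x - remainder q q0 w2 x) by exact: LpB.
have BB := LpB y_exp mD B1 B2.
have E1 := bounded_linear_onB bSoo B1 B2.
have LS1 := Soo_closed B1; have LS2 := Soo_closed B2.
have -> : Lpnorm p D (fun y => fixed_point_map w1 y - fixed_point_map w2 y) =
  Lpnorm p D (Soo (fun x => volume_potential (remainder q q0 w1) x -
                            volume_potential (remainder q q0 w2) x)).
  apply: eq_Lpnorm => //.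
  - exact: Lpm (LpB y_exp mD LS1 LS2).
  - exact: Lpm (Soo_closed BB).
  - by apply: filterS E1 => x H Dx; rewrite H.
apply: (le_trans (H1 _ _ hp BB)).
have -> : Lpnorm p D (fun x => volume_potential (remainder q q0 w1) x -
                            volume_potential (remainder q q0 w2) x) =
   Lpnorm p D (volume_potential (fun x => remainder q q0 w1 x - remainder q q0 w2 x)).
  apply: eq_Lpnorm => //; [exact: Lpm BB|exact: Lpm (HM _ RB).1|].
  by apply: aeW => x Dx; rewrite volume_potentialB.
have r0 : 0 <= C * (r1 `^ alpha + r2 `^ alpha).
  by rewrite mulr_ge0 ?(ltW C0)// addr_ge0 ?powR_ge0.
apply: (@le_trans _ _ ((C1 + 1)%:E * (M%:E * ((C * (r1 `^ alpha + r2 `^ alpha))%:E *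
    Lpnorm p D (fun y => w1 y - w2 y)%R)))%E).
  apply: lee_pmul; rewrite ?lee_fin ?Lpnorm_ge0 ?lerDl//.
  apply: (le_trans ((HM _ RB).2 _ hp)).
  by apply: lee_wpmul2l; [rewrite lee_fin ltW|exact: HC].
by rewrite !muleA -!EFinM !mulrA.
Qed.

Lemma fixed_point_map0 : Lpnorm +oo D (fixed_point_map (fun=> 0)) = 0%E.
Proof.
have [M M0 HM] := volume_potential_bound; have [C1 C10 H1] := Soo_bound.
have L0 : Lp +oo D (fun=> 0 : R[i]).
  apply/LpP; split; first exact: measurable_on_cst.
  by rewrite Lpnorm_ae0//; apply: aeW.
have N0 : Lpnorm +oo D (fun=> 0 : R[i]) = 0%E.
  by apply: Lpnorm_ae0 => //; apply: aeW.
apply/eqP; rewrite eq_le Lpnorm_ge0 andbT /fixed_point_map remainder0.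
apply: (le_trans (H1 _ _ y_exp (HM _ L0).1)).
apply: (le_trans (lee_wpmul2l _ ((HM _ L0).2 _ y_exp))); first by rewrite lee_fin.
by rewrite N0 !mule0.
Qed.

Lemma V0_bound : exists2 C : R, 0 < C & forall p f, Lp_exponent p -> Lp +oo D f ->
  (Lpnorm p D (V0 k D q0 f) <= C%:E * Lpnorm p D f)%E.
Proof.
have [M M0 HM] := volume_potential_bound; have [C1 C10 H1] := Soo_bound.
have [b b0 hb] := linear_contrast_bound hq.
exists (C1 * M * b + 1); first by rewrite ltr_wpDl// !mulr_ge0// ltW.
move=> p f hp Lf; have [LV VE] := V0P Lf; have Ll := Lpy_linear_part Lf.
have Lq := Lpy_q0M hq mD Lf.
rewrite (eq_Lpnorm hp mD (Lpm LV) (Lpm (Soo_closed Ll)) VE).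
apply: (le_trans (H1 _ _ hp Ll)).
apply: (@le_trans _ _ (C1%:E * (M%:E * (b%:E * Lpnorm p D f)))%E).
  apply: lee_wpmul2l; rewrite ?lee_fin//.
  apply: (le_trans ((HM _ Lq).2 _ hp)); apply: lee_wpmul2l; rewrite ?lee_fin ?(ltW M0)//.
  apply: le_Lpnorm_scale => //; [exact: Lpm Lq|exact: Lpm Lf|].
  by apply: filterS hb => x bx _; rewrite cnormM cnorm_real ler_wpM2r// cnorm_ge0.
rewrite !muleA -!EFinM; apply: lee_wpmul2r; first exact: Lpnorm_ge0.
by rewrite lee_fin lerDl.
Qed.

End scattering_operators.

Local Close Scope complex_scope.

(** The inclusion guarantees that [fine] is applied to finite norms, so that the triangle inequality
    survives it. *)
Lemma Lpnorm_seminorm_on (R : realType) d (D : set 'rV[R]_d) (p : \bar R) :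
  Lp_exponent p -> measurable D -> Lp +oo D `<=` Lp p D ->
  seminorm_on (Lp +oo D) (fun f => fine (Lpnorm p D f)).
Proof.
move=> hp mD sub; split.
- by move=> f; rewrite fine_ge0// Lpnorm_ge0.
- by rewrite Lpnorm_ae0//; apply: aeW.
- move=> f g Lf Lg; have [Lf' Lg'] := (sub _ Lf, sub _ Lg).
  have Lfg := LpB hp mD Lf' Lg'.
  rewrite -fineD ?Lpnorm_fin_num// fine_le ?fin_numD ?Lpnorm_fin_num//.
  by apply: LpnormB => //; [case/LpP: Lf|case/LpP: Lg].
Qed.

Theorem proposition2p6 (R : realType) (d : nat) (k : R) (D : set 'rV[R]_d)
    (q : 'rV[R]_d -> R -> R) (q0 : 'rV[R]_d -> R) (alpha : R)
    (hd : d = 2%N \/ d = 3%N) (hk : 0 < k)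
    (hDo : open D) (hDb : bounded_set D)
    (hq : contrast D q q0 alpha) (hqc : continuous_representative q)
    (hiso2 : isomorphism_on 2%:E D (linear_op k D q0))
    (hisoy : isomorphism_on +oo%E D (linear_op k D q0)) :
  exists2 delta : R, 0 < delta &
  exists V : ('rV[R]_d -> R[i]) -> 'rV[R]_d -> R[i],
    (forall f, Linfty_ball D delta f ->
       [/\ Lp +oo%E D (V f), integral_equation k D q f (V f),
           Linfty_ball D delta (fun x => V f x - V0 k D q0 f x) &
           forall v, Lp +oo%E D v -> integral_equation k D q f v ->
             Linfty_ball D delta (fun x => v x - V0 k D q0 f x) ->
             v = V f %[ae leb R d in D]]) /\
    exists2 C : R, 0 < C & forall f, Linfty_ball D delta f ->
      [/\ (Lpnorm +oo D (V f) <= C%:E * Lpnorm +oo D f)%E,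
          (Lpnorm 2%:E D (V f) <= C%:E * Lpnorm 2%:E D f)%E,
          (Lpnorm +oo D (fun x => V f x - V0 k D q0 f x)%R
             <= C%:E * Lpnorm +oo D f `^ (1 + alpha)%R)%E &
          (Lpnorm 2%:E D (fun x => V f x - V0 k D q0 f x)%R
             <= C%:E * (Lpnorm +oo D f `^ alpha * Lpnorm 2%:E D f))%E].
Proof.
have mD := open_rV_measurable hDo.
have Doo := leb_bounded_lty mD hDb.
have [bT2 [S2 [bS2 S2T TS2]]] := hiso2.
have [bToo [Soo [bSoo SooT TSoo]]] := hisoy.
have ye : @Lp_exponent R +oo%E by right.
have e2 : @Lp_exponent R 2%:E by left.
have L2 : Lp +oo D `<=` Lp 2%:E D by move=> f; exact: Lpy_sub_Lp2.
have [C1 C10 HC1] := fixed_point_map_lipschitz hd hk mD hDb hq hqc bT2 bS2 bSoo S2T TSoo.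
have [C2 C20 HC2] := V0_bound hd hk mD hDb hq bT2 bS2 bSoo S2T TS2 TSoo.
pose F := fixed_point_map k D q q0 Soo.
pose L := V0 k D q0.
(* One constant dominates the Lipschitz constant of [F], the norm of [V0] and 1, as the abstract
   lemma expects. *)
pose M := C1 + C2 + 1.
have [C1M C2M M1] : [/\ C1 <= M, C2 <= M & 1 <= M] by rewrite /M; split; lra.
have finy f : Lp +oo D f -> Lpnorm +oo D f \is a fin_num by exact: Lpnorm_fin_num.
have fin2 f : Lp +oo D f -> Lpnorm 2%:E D f \is a fin_num.
  by move=> Lf; apply: Lpnorm_fin_num; exact: L2.
have V0y f : Lp +oo D f -> Lp +oo D (L f).
  by move=> Lf; have [] := V0P hd hk mD hDb hq bT2 bS2 bSoo S2T TS2 TSoo Lf.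
pose X : zmodType := ('rV[R]_d -> R[i])%type.
pose n1 (f : X) := fine (Lpnorm +oo D f).
pose n2 (f : X) := fine (Lpnorm 2%:E D f).
have n1E f : Lp +oo D f -> (n1 f)%:E = Lpnorm +oo D f by move=> Lf; rewrite fineK// finy.
have n2E f : Lp +oo D f -> (n2 f)%:E = Lpnorm 2%:E D f by move=> Lf; rewrite fineK// fin2.
have EB (f g : X) : Lp +oo D f -> Lp +oo D g -> Lp +oo D (f - g) by exact: LpB.
have ED (f g : X) : Lp +oo D f -> Lp +oo D g -> Lp +oo D (f + g) by exact: LpD.
have E0 : Lp +oo D (0 : X).
  apply/LpP; split; first exact: measurable_on_cst.
  by rewrite Lpnorm_ae0//; apply: aeW.
have EF (w : X) : Lp +oo D w -> n1 w <= 1 -> Lp +oo D (F w).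
  move=> Lw w1; apply: (Lpy_fixed_point_map hd hk mD hDb hq hqc bSoo Lw).
  by rewrite -n1E// lee_fin.
have [||||||||delta [d0 dM] [C C0 HC]] := @small_perturbation_fixed_point R X (Lp +oo D)
    n1 n2 F L M alpha E0 EB _ _ _ _ M1 (contrast_alpha hq) EF.
- exact: Lpnorm_seminorm_on.
- exact: Lpnorm_seminorm_on.
- move=> f Lf; have [mf _] := (LpP _ _ _).1 Lf; move=> f0.
  have {}f0 : Lpnorm +oo D f = 0%E by rewrite -n1E// f0.
  by rewrite /n2 (Lpnorm_ae0 e2 mD mf)//; exact: (Lpnorm_eq0 ye mD mf f0).
- move=> u c Lu du.
  have [i|l Ll Hl] := @Linfty_complete R d D u c mD Lu.
    by rewrite -[X in (X <= _)%E]n1E ?lee_fin ?du//; exact: EB.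
  exists l => // i; rewrite -lee_fin n1E; [exact: Hl|exact: EB].
- move=> n w1 w2 hn L1 Lw2 N1 N2.
  have H p : Lp_exponent p -> (forall f, Lp +oo D f -> Lpnorm p D f \is a fin_num) ->
      fine (Lpnorm p D (F w1 - F w2)) <=
      M * (n1 w1 `^ alpha + n1 w2 `^ alpha) * fine (Lpnorm p D (w1 - w2)).
    move=> hp finp.
    have := HC1 p w1 w2 (n1 w1) (n1 w2) hp L1 Lw2 N1 N2.
    rewrite !n1E// => /(_ (lexx _) (lexx _)) H.
    rewrite -lee_fin EFinM !fineK ?finp//; [|exact: EB|exact: EB (EF _ _ _) (EF _ _ _)].
    apply: (le_trans H); apply: lee_wpmul2r; first exact: Lpnorm_ge0.
    by rewrite lee_fin ler_wpM2r// addr_ge0 ?powR_ge0.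
  by case: hn => ->; exact: H.
- have E : Lpnorm +oo D (F 0) = 0%E.
    exact: (fixed_point_map0 q hd hk mD hDb bT2 bS2 bSoo S2T TSoo).
  by rewrite /n1 E.
- exact: V0y.
- move=> n f hn Lf.
  have H p : Lp_exponent p -> (forall f, Lp +oo D f -> Lpnorm p D f \is a fin_num) ->
      fine (Lpnorm p D (L f)) <= M * fine (Lpnorm p D f).
    move=> hp finp; rewrite -lee_fin EFinM !fineK ?finp//; last exact: V0y.
    apply: (le_trans (HC2 p f hp Lf)); apply: lee_wpmul2r; rewrite ?Lpnorm_ge0//.
  by case: hn => ->; exact: H.
have ballP f : Linfty_ball D delta f <-> Lp +oo D f /\ n1 f <= delta.
  by split=> -[Lf fd]; split => //; [rewrite -lee_fin n1E|rewrite -n1E// lee_fin].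
(* The solution operator is a choice function; outside the ball it takes the value 0, about which
   nothing is claimed. *)
have /choice[V HV] : forall f, exists v, Linfty_ball D delta f -> [/\ Lp +oo D v,
    n1 (v - L f - F (v + f)) = 0, n1 (v - L f) <= delta,
    (forall v', Lp +oo D v' -> n1 (v' - L f - F (v' + f)) = 0 ->
       n1 (v' - L f) <= delta -> n1 (v' - v) = 0) &
    [/\ n1 v <= C * n1 f, n2 v <= C * n2 f,
     n1 (v - L f) <= C * n1 f `^ (1 + alpha) &
     n2 (v - L f) <= C * (n1 f `^ alpha * n2 f)]].
  move=> f; have [/ballP[Lf fd]|nf] := pselect (Linfty_ball D delta f).
    by have [v Hv] := HC f Lf fd; exists v.
  by exists 0.
have fixP f v : Linfty_ball D delta f -> Lp +oo D v -> n1 (v - L f) <= delta ->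
    integral_equation k D q f v <-> n1 (v - L f - F (v + f)) = 0.
  move=> /ballP[Lf fd] Lv vd.
  (* The sum is bounded by [delta + M * delta + delta], and [(M + 2) * delta <= 1] was kept for this
     purpose: it opens the equivalence between the integral equation and the fixed-point form. *)
  have w1 : n1 (v + f) <= 1.
    rewrite (_ : v + f = (v - L f) + (L f + f)); last by rewrite addrA subrK.
    have sn := @Lpnorm_seminorm_on R d D +oo%E ye mD (fun=> id).
    have Lvl : Lp +oo D (v - L f) by apply: EB => //; exact: V0y.
    have Hl : n1 (L f) <= C2 * n1 f.
      by rewrite -lee_fin EFinM !n1E//; [exact: HC2|exact: V0y].
    apply: (le_trans (seminorm_onD E0 EB sn Lvl (ED _ _ (V0y _ Lf) Lf))).
    have := seminorm_onD E0 EB sn (V0y _ Lf) Lf.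
    have : C2 * n1 f <= M * delta by rewrite ler_pM// ?(ltW C20)// /n1 fine_ge0// Lpnorm_ge0.
    rewrite -/(n1 _) -/(n1 _) -/(n1 _) -/(n1 _); lra.
  have Lw : Lp +oo D (v + f) by exact: ED.
  have Lh : Lp +oo D (v - L f - F (v + f)).
    by apply: (EB _ _); [apply: EB => //; exact: V0y|exact: EF].
  rewrite (integral_equationP hd hk mD hDb hq hqc bT2 bToo bS2 bSoo S2T TS2 SooT TSoo Lf Lv); last first.
    by rewrite -[X in (X <= _)%E](n1E _ Lw) lee_fin.
  have [mh _] := (LpP _ _ _).1 Lh.
  split => H.
    have : Lpnorm +oo D (v - L f - F (v + f)) = 0%E.
      apply: (Lpnorm_ae0 ye mD mh); apply: filterS H => x H Dx.
      change (v x - L f x - F (v + f) x = 0).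
      by apply/eqP; rewrite -addrA -opprD subr_eq0; apply/eqP; exact: H.
    by rewrite /n1 => ->.
  have /(Lpnorm_eq0 ye mD mh) : Lpnorm +oo D (v - L f - F (v + f)) = 0%E by rewrite -n1E// H.
  apply: filterS => x /[apply] Hx.
  have {Hx} : v x - L f x - F (v + f) x = 0 by exact: Hx.
  by move/eqP; rewrite -addrA -opprD subr_eq0 => /eqP.
exists delta => //; exists V; split.
  move=> f Bf; have [LV V1 V2 V3 _] := HV f Bf; have [Lf fd] := (ballP f).1 Bf.
  split => //.
  - exact/(fixP f).
  - by apply/ballP; split => //; apply: EB => //; exact: V0y.
  - move=> v Lv /(fixP f) vE /ballP[_ vd].
    have {}vE := vE Bf Lv vd.
    have Lvv := EB _ _ Lv LV; have [mvv _] := (LpP _ _ _).1 Lvv.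
    have /(Lpnorm_eq0 ye mD mvv) : Lpnorm +oo D (v - V f) = 0%E by rewrite -n1E// (V3 v Lv vE vd).
    apply: filterS => x /[apply] Hx; have {Hx} : v x - V f x = 0 by exact: Hx.
    by move/eqP; rewrite subr_eq0 => /eqP.
exists C => // f Bf; have [LV _ _ _ [b1 b2 b3 b4]] := HV f Bf.
have [Lf _] := (ballP f).1 Bf.
have LVL : Lp +oo D (V f - L f) by apply: EB => //; exact: V0y.
split.
- by rewrite -!n1E// -EFinM lee_fin.
- by rewrite -!n2E// -EFinM lee_fin.
- by rewrite -[X in (X <= _)%E](n1E _ LVL) -n1E// poweR_EFin -EFinM lee_fin.
- by rewrite -[X in (X <= _)%E](n2E _ LVL) -n1E// -n2E// poweR_EFin -!EFinM lee_fin.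
Qed.
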